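(* (i) Given an $n$-qubit density matrix $\rho$ as an MPO of bond dimension $\chi$ with $A=\{1,\dots,n_A\}$ and $B$ its complement, the CCNR negativity $\mathcal{C}(\rho)$ and the realignment moments $r_\alpha(\rho)$ can be computed with cost $O(n\chi^3)$. (ii) Given an $n$-qubit pure state $|\psi\rangle$ as an MPS of bond dimension $\chi$, with $A=\{1,\dots,n_A\}$, $B=\{n_A+1,\dots,n_A+n_B\}$ and $C$ the remaining sites at the right boundary, for $\rho=\mathrm{tr}_C(|\psi\rangle\langle\psi|)$ the CCNR negativity $\mathcal{C}(\rho)$ can be computed with cost $O(\chi^6+n\chi^5)$, and the realignment moment $r_4(\rho)$ can be computed with cost $O(n\chi^5)$.
   Context: An MPS of bond dimension $\chi$ is $|\psi\rangle=\sum_{s_1,\dots,s_n\in\{0,1\}}A_1^{s_1}\cdots A_n^{s_n}|s_1,\dots,s_n\rangle$ with $\chi\times\chi$ matrices $A_i^{s_i}$ (row/column vectors at the left/right boundary). An MPO of bond dimension $\chi$ is $\rho=\sum_{s,s'}W_1^{s_1,s_1'}\cdots W_n^{s_n,s_n'}|s_1,\dots,s_n\rangle\langle s_1',\dots,s_n'|$ with $\chi\times\chi$ matrices $W_i^{s_i,s_i'}$ (boundary row/column vectors likewise). The realignment matrix is $\langle a,a'|R_\rho|b,b'\rangle=\langle a,b|\rho|a',b'\rangle$; $r_\alpha(\rho)=\mathrm{tr}((R_\rho^\dagger R_\rho)^{\alpha/2})$; $\mathcal{C}(\rho)=\ln\|R_\rho\|_1$ (trace norm). Cost means the number of elementary arithmetic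 operations (with standard dense singular value and eigenvalue decompositions of a $D\times D$ matrix counted as $O(D^3)$ operations), local dimension $2$. *)

(* Defs.v *)
From HB Require Import structures.
From mathcomp Require Import all_boot all_order all_algebra.
From mathcomp Require Import complex.
From mathcomp Require Import all_classical all_reals exp.

Set Implicit Arguments.
Unset Strict Implicit.
Unset Printing Implicit Defensive.

Import Order.TTheory GRing.Theory Num.Theory.

Local Open Scope ring_scope.
Local Open Scope complex_scope.
Local Open Scope sesquilinear_scope.

Definition mxof (R : realType) (S T : finType) (f : S -> T -> R[i]) :
    'M[R[i]]_(#|S|, #|T|) :=
  \matrix_(i, j) f (enum_val i) (enum_val j).

Definition mxval (R : realType) (S T : finType) (M : 'M[R[i]]_(#|S|, #|T|))
    (s : S) (t : T) : R[i] :=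
  M (enum_rank s) (enum_rank t).

Definition density_matrix (R : realType) (D : nat) (rho : 'M[R[i]]_D) : Prop :=
  [/\ rho \is hermsymmx,
      forall v : 'cV[R[i]]_D, 0 <= (v ^t* *m rho *m v) 0 0
    & \tr rho = 1].

(* Power [H ^ p] of a positive semidefinite matrix by functional calculus. *)
Definition hpow (R : realType) (D : nat) (H : 'M[R[i]]_D) (p : R) :
    'M[R[i]]_D :=
  invmx (spectralmx H)
    *m diag_mx (map_mx (fun x : R[i] => ((complex.Re x) `^ p)%:C) (spectral_diag H))
    *m spectralmx H.

(* Realignment; [s ++ t] is the configuration [s] on A followed by [t] on B. *)

Definition realign (R : realType) (nA nB : nat)
    (rho : 'M[R[i]]_#|{: (nA + nB).-tuple bool}|) :
    'M[R[i]]_(#|{: nA.-tuple bool * nA.-tuple bool}|,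
              #|{: nB.-tuple bool * nB.-tuple bool}|) :=
  mxof (fun (a : nA.-tuple bool * nA.-tuple bool)
            (b : nB.-tuple bool * nB.-tuple bool) =>
    mxval rho [tuple of a.1 ++ b.1] [tuple of a.2 ++ b.2]).

Arguments realign {R} nA nB rho.

Definition realign_moment (R : realType) (nA nB : nat) (alpha : R)
    (rho : 'M[R[i]]_#|{: (nA + nB).-tuple bool}|) : R[i] :=
  let Q := realign nA nB rho in \tr (hpow (Q ^t* *m Q) (alpha / 2)).

Definition trace_norm (R : realType) (p q : nat) (M : 'M[R[i]]_(p, q)) : R :=
  complex.Re (\tr (hpow (M ^t* *m M) 2^-1)).

Definition ccnr_negativity (R : realType) (nA nB : nat)
    (rho : 'M[R[i]]_#|{: (nA + nB).-tuple bool}|) : R :=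
  ln (trace_norm (realign nA nB rho)).

Arguments realign_moment {R} nA nB alpha rho.
Arguments ccnr_negativity {R} nA nB rho.

(* Matrix products of bond dimension [chi] on [n >= 2] sites, with physical
   index in [I].  Sites are numbered from 0; the tensor of site [i.+1] is
   [bulk i], the first and the last sites carry row and column vectors. *)

Record train (R : realType) (I : Type) (n chi : nat) := Train {
  lbound : I -> 'rV[R[i]]_chi;
  bulk : 'I_(n - 2) -> I -> 'M[R[i]]_chi;
  rbound : I -> 'cV[R[i]]_chi }.

Definition train_val (R : realType) (I : Type) (n chi : nat)
    (A : train R I n chi) (s : nat -> I) : R[i] :=
  (lbound A (s 0%N)
     *m \big[mulmx/1%:M]_(i < n - 2) bulk A i (s i.+1)
     *m rbound A (s n.-1)) 0 0.

Definition mps (R : realType) (n chi : nat) := train R bool n chi.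
Definition mpo (R : realType) (n chi : nat) := train R (bool * bool)%type n chi.

Definition mps_ket (R : realType) (n chi : nat) (A : mps R n chi)
    (s : n.-tuple bool) : R[i] :=
  train_val A (nth false s).

Definition mpo_mx (R : realType) (n chi : nat) (W : mpo R n chi) :
    'M[R[i]]_#|{: n.-tuple bool}| :=
  mxof (fun s t : n.-tuple bool =>
    train_val W (fun i => (nth false s i, nth false t i))).

Definition normalized (R : realType) (n : nat) (psi : n.-tuple bool -> R[i]) :
    Prop :=
  \sum_s `|psi s| ^+ 2 = 1.

(* Partial trace of |psi><psi| over the last [nC] sites. *)
Definition reduced (R : realType) (nAB nC : nat)
    (psi : (nAB + nC).-tuple bool -> R[i]) :
    'M[R[i]]_#|{: nAB.-tuple bool}| :=
  mxof (fun s t : nAB.-tuple bool =>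
    \sum_(c : nC.-tuple bool)
      psi [tuple of s ++ c] * (psi [tuple of t ++ c])^*%R).

(* Dense linear algebra: an arbitrary choice of eigenvalue decompositions of
   Hermitian matrices and of singular value decompositions. *)

Definition is_eigh (R : realType) (D : nat) (M : 'M[R[i]]_D)
    (d : 'M[R[i]]_D * 'rV[R]_D) : Prop :=
  d.1 \is unitarymx /\
  M = d.1 *m diag_mx (map_mx (fun x : R => x%:C) d.2) *m d.1 ^t*.

Definition is_svd (R : realType) (D : nat) (M : 'M[R[i]]_D)
    (d : 'M[R[i]]_D * 'rV[R]_D * 'M[R[i]]_D) : Prop :=
  [/\ d.1.1 \is unitarymx, d.2 \is unitarymx,
      forall j, 0 <= d.1.2 0 j
    & M = d.1.1 *m diag_mx (map_mx (fun x : R => x%:C) d.1.2) *m d.2 ^t*].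

Record dense_solver (R : realType) := DenseSolver {
  eigh : forall D : nat, 'M[R[i]]_D -> 'M[R[i]]_D * 'rV[R]_D;
  svd : forall D : nat, 'M[R[i]]_D -> 'M[R[i]]_D * 'rV[R]_D * 'M[R[i]]_D;
  eighP : forall (D : nat) (M : 'M[R[i]]_D), M \is hermsymmx -> is_eigh M (eigh M);
  svdP : forall (D : nat) (M : 'M[R[i]]_D), is_svd M (svd M) }.

(* Solvers exist: quantifying over them is not vacuous. *)
Section SolverExists.
Variable R : realType.
Local Notation C := R[i].
Local Notation toC := (map_mx (fun x : R => x%:C)).

Lemma eigh_exists (D : nat) (M : 'M[C]_D) :
  exists d, M \is hermsymmx -> is_eigh M d.
Proof.
have [Mh|] := boolP (M \is hermsymmx); last by exists (0, 0).
have /orthomx_spectralP EM := hermitian_normalmx Mh.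
have Pu := spectral_unitarymx M.
exists ((spectralmx M) ^t*, map_mx (@complex.Re R) (spectral_diag M)) => _.
have Ed : toC (map_mx (@complex.Re R) (spectral_diag M)) = spectral_diag M.
  apply/rowP => j; rewrite !mxE.
  have /mxOverP/(_ 0 j) := hermitian_spectral_diag_real Mh.
  by case: (spectral_diag M 0 j) => a b /complex_realP[x ->].
split; first by rewrite trmxC_unitary.
by rewrite [d in diag_mx d]Ed [(_, _).1]/= trmxCK -(invmx_unitary Pu).
Qed.

Lemma orthogonal_rows_fill (D : nat) (N : 'M[C]_D) :
    (forall i j, i != j -> \sum_k N i k * (N j k)^*%R = 0) ->
  exists2 Q : 'M[C]_D, Q \is unitarymx &
    forall i, exists2 s : R, 0 <= s & forall k, N i k = s%:C * Q i k.
Proof.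
have [m] := ubnP #|[set i | row i N == 0]|; elim: m N => // m IHm N leNm oN.
case: (pickP [pred i | row i N == 0]) => [i0 /= /eqP Ni0|N_neq0]; last first.
  pose sq i := \sum_k N i k * (N i k)^*%R.
  have sq_gt0 i : 0 < sq i.
    have -> : sq i = dotmx (row i N) (row i N).
      by rewrite dotmxE mxE; apply: eq_bigr => k _; rewrite !mxE.
    by apply: dotmx_is_dotmx; apply: negbT; exact: N_neq0.
  pose nr i : C := sqrtC (sq i).
  have nr_gt0 i : 0 < nr i by rewrite sqrtC_gt0.
  have nr_neq0 i : nr i != 0 by rewrite gt_eqF.
  have nrR i : nr i \is Num.real by exact: gtr0_real.
  have nrE i : exists2 s : R, 0 <= s & nr i = s%:C.
    have /complex_realP[x xE] := nrR i; exists x => //.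
    by rewrite -lecR -xE ltW.
  exists (\matrix_(i, j) ((nr i)^-1 * N i j)).
    apply/unitarymxP/matrixP => i j; rewrite !mxE.
    transitivity ((nr i)^-1 * (nr j)^-1 * \sum_k N i k * (N j k)^*%R).
      rewrite mulr_sumr; apply: eq_bigr => k _; rewrite !mxE.
      have -> : ((nr j)^-1 * N j k)^*%R = (nr j)^-1 * (N j k)^*%R.
        by rewrite rmorphM; congr (_ * _); apply/CrealP; rewrite realV.
      by rewrite mulrACA.
    have [<-|ne_ij] := eqVneq i j; last by rewrite oN // mulr0.
    rewrite -/(sq i) -(sqrtCK (sq i)) -/(nr i) expr2 mulrACA mulVf //.
    by rewrite mulr1.
  move=> i; have [s s0 sE] := nrE i; exists s => // k.
  by rewrite !mxE -sE mulrA mulfV ?mul1r.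
have rN : (\rank (N ^t*) < D)%N.
  rewrite ltn_neqAle rank_leq_row andbT mxrank_map mxrank_tr.
  apply/eqP => rN; have : row_free N by rewrite /row_free rN.
  move=> /row_freeP[B NB]; have := congr1 (row i0) NB.
  rewrite row_mul Ni0 mul0mx => /rowP/(_ i0).
  by rewrite !mxE eqxx => /eqP; rewrite eq_sym oner_eq0.
have : kermx (N ^t*) != 0 by rewrite -mxrank_eq0 mxrank_ker subn_eq0 -ltnNge.
move=> /rowV0Pn[v /sub_kermxP vN v_neq0].
have oNv i : \sum_k v 0 k * (N i k)^*%R = 0.
  have /rowP/(_ i) := vN; rewrite !mxE => E; rewrite -[RHS]E.
  by apply: eq_bigr => k _; rewrite !mxE.
have oNv' i : \sum_k N i k * (v 0 k)^*%R = 0.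
  have := congr1 (@Num.conj C) (oNv i); rewrite rmorph0 rmorph_sum => E.
  by rewrite -[RHS]E; apply: eq_bigr => k _; rewrite rmorphM mulrC; congr (_ * _); exact/esym/conjCK.
pose N' : 'M_D := \matrix_(i, j) (if i == i0 then v 0 j else N i j).
have [||Q Qu QN] := IHm N'.
- rewrite -ltnS; apply: leq_trans leNm; rewrite ltnS; apply: proper_card; apply/properP; split.
    apply/fintype.subsetP => i; rewrite !inE; have [->|ne] := eqVneq i i0.
      by rewrite Ni0.
    by move=> /eqP/rowP E; apply/eqP/rowP => j; have := E j; rewrite !mxE (negPf ne).
  exists i0; rewrite !inE ?Ni0 //; apply: contra v_neq0 => /eqP/rowP E.
  by apply/eqP/rowP => j; have := E j; rewrite !mxE eqxx.
- move=> i j ne.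
  under eq_bigr do rewrite !mxE.
  have [ii|nei] := eqVneq i i0; have [jj|nej] := eqVneq j i0 => //.
  + by rewrite ii jj eqxx in ne.
  + exact: oN.
exists Q => // i; have [ii|ne] := eqVneq i i0.
  exists 0 => // k; rewrite mul0r ii; move: Ni0 => /rowP/(_ k).
  by rewrite !mxE.
have [s s0 sE] := QN i; exists s => // k.
by rewrite -sE mxE (negPf ne).
Qed.

Lemma svd_exists (D : nat) (M : 'M[C]_D) : exists d, is_svd M d.
Proof.
have [[U lam] /= hU] := eigh_exists (M *m M ^t*).
have [|Uu EM] := hU.
  apply/is_hermitianmxP; rewrite expr0 scale1r.
  by rewrite trmx_mul map_mxM trmxCK.
have Uu' : U ^t* \is unitarymx by rewrite trmxC_unitary.
pose N := U ^t* *m M.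
have EN : N *m N ^t* = diag_mx (toC lam).
  rewrite trmx_mul map_mxM trmxCK mulmxA -(mulmxA _ M) EM.
  rewrite !mulmxA.
  have /unitarymxP := Uu'; rewrite trmxCK => E.
  by rewrite E mul1mx -mulmxA E mulmx1.
have [|Q Qu QN] := @orthogonal_rows_fill _ N.
  move=> i j ne; have /matrixP/(_ i j) := EN; rewrite !mxE (negPf ne) mulr0n => E.
  by rewrite -[RHS]E; apply: eq_bigr => k _; rewrite !mxE.
have /choice[s sP] i : exists s : R, 0 <= s /\ forall k, N i k = s%:C * Q i k.
  by have [x x0 xE] := QN i; exists x.
have Qu' : Q ^t* \is unitarymx by rewrite trmxC_unitary.
have s_ge0 j : 0 <= (\row_j s j) 0 j by rewrite mxE; case: (sP j).
have E : M = U *m diag_mx (toC (\row_j s j)) *m Q ^t* ^t*.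
  rewrite trmxCK -mulmxA.
  have -> : diag_mx (toC (\row_j s j)) *m Q = N.
    by apply/matrixP => i k; have [_ ->] := sP i; rewrite mul_diag_mx !mxE.
  by rewrite /N mulmxA (unitarymxP Uu) mul1mx.
by exists (U, \row_j s j, Q ^t*); exact: And4 Uu Qu' s_ge0 E.
Qed.

Lemma dense_solver_exists : inhabited (dense_solver R).
Proof.
pose e D M := xget (0, 0) [set d | M \is hermsymmx -> @is_eigh R D M d]%classic.
pose s D M := xget (0, 0, 0) [set d | @is_svd R D M d]%classic.
have eP D M : M \is hermsymmx -> @is_eigh R D M (e D M).
  by rewrite /e; case: xgetP => [d _ //|]; case: (eigh_exists M) => d hd /(_ d hd).
have sP D M : @is_svd R D M (s D M).
  by rewrite /s; case: xgetP => [d _ //|]; case: (svd_exists M) => d hd /(_ d hd).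
exact: (inhabits (DenseSolver eP sP)).
Qed.

End SolverExists.

(* Algorithms are programs of a loop language, uniform in all size parameters.
   Array cells, addressed by an array name and a list of indices, hold complex
   numbers.  Index expressions only see the size parameters and the loop
   counters.  There is no data-dependent control flow, so the cost of a program
   depends on the size parameters alone. *)

Inductive nexp : Type :=
| NVar of nat
| NCst of nat
| NAdd of nexp & nexp
| NSub of nexp & nexp
| NMul of nexp & nexp.

Inductive sexp : Type :=
| SGet of nat & seq nexp
| SCst of nat
| SAdd of sexp & sexp
| SSub of sexp & sexp
| SMul of sexp & sexp
| SDiv of sexp & sexp
| SConj of sexp
| SPow of sexp & sexp
| SLn of sexp.

(* [Eigh D a u l]: decompose the [D] x [D] matrix in array [a], eigenvectors
   into the columns of [u] and eigenvalues into [l].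
   [Svd D a u l w]: likewise, left and right singular vectors into [u], [w]. *)
Inductive cmd : Type :=
| Skip
| Assign of nat & seq nexp & sexp
| Seqc of cmd & cmd
| For of nat & nexp & cmd
| Eigh of nexp & nat & nat & nat
| Svd of nexp & nat & nat & nat & nat.

Definition nenv := nat -> nat.

Definition bind (v : nenv) (x k : nat) : nenv :=
  fun y => if y == x then k else v y.

Fixpoint neval (v : nenv) (e : nexp) : nat :=
  match e with
  | NVar x => v x
  | NCst k => k
  | NAdd e1 e2 => neval v e1 + neval v e2
  | NSub e1 e2 => neval v e1 - neval v e2
  | NMul e1 e2 => neval v e1 * neval v e2
  end%N.

Definition mem (R : realType) := nat -> seq nat -> R[i].

Definition put (R : realType) (m : mem R) (a : nat) (ix : seq nat) (z : R[i]) :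
    mem R :=
  fun b jx => if (b == a) && (jx == ix) then z else m b jx.

(* [SPow] and [SLn] are real functions, applied to real parts. *)
Fixpoint seval (R : realType) (v : nenv) (m : mem R) (e : sexp) : R[i] :=
  match e with
  | SGet a ix => m a (map (neval v) ix)
  | SCst k => k%:R
  | SAdd e1 e2 => seval v m e1 + seval v m e2
  | SSub e1 e2 => seval v m e1 - seval v m e2
  | SMul e1 e2 => seval v m e1 * seval v m e2
  | SDiv e1 e2 => seval v m e1 / seval v m e2
  | SConj e1 => (seval v m e1)^*%R
  | SPow e1 e2 => (complex.Re (seval v m e1) `^ complex.Re (seval v m e2))%:C
  | SLn e1 => (ln (complex.Re (seval v m e1)))%:C
  end.

Fixpoint sops (e : sexp) : nat :=
  match e with
  | SGet _ _ | SCst _ => 0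
  | SAdd e1 e2 | SSub e1 e2 | SMul e1 e2 | SDiv e1 e2 | SPow e1 e2 =>
      (sops e1 + sops e2).+1
  | SConj e1 | SLn e1 => (sops e1).+1
  end%N.

Definition entry (R : realType) (p q : nat) (z : R[i]) (M : 'M[R[i]]_(p, q))
    (i j : nat) : R[i] :=
  if insub i is Some i' then if insub j is Some j' then M i' j' else z else z.

Definition load_mx (R : realType) (D : nat) (m : mem R) (a : nat) :
    'M[R[i]]_D :=
  \matrix_(i, j) m a [:: val i; val j].

Definition store_mx (R : realType) (D : nat) (m : mem R) (a : nat)
    (M : 'M[R[i]]_D) : mem R :=
  fun b ix =>
    if (b == a) && (size ix == 2)
    then entry (m b ix) M (nth 0%N ix 0) (nth 0%N ix 1) else m b ix.

Definition store_rv (R : realType) (D : nat) (m : mem R) (a : nat)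
    (d : 'rV[R]_D) : mem R :=
  fun b ix =>
    if (b == a) && (size ix == 1)
    then entry (m b ix) (map_mx (fun x : R => x%:C) d) 0 (nth 0%N ix 0)
    else m b ix.

Fixpoint exec (R : realType) (S : dense_solver R) (c : cmd) (v : nenv)
    (m : mem R) : mem R :=
  match c with
  | Skip => m
  | Assign a ix e => put m a (map (neval v) ix) (seval v m e)
  | Seqc c1 c2 => exec S c2 v (exec S c1 v m)
  | For x e c1 =>
      foldl (fun m' k => exec S c1 (bind v x k) m') m (iota 0 (neval v e))
  | Eigh e a u l =>
      let d := eigh S (load_mx (neval v e) m a) in
      store_rv (store_mx m u d.1) l d.2
  | Svd e a u l w =>
      let d := svd S (load_mx (neval v e) m a) in
      store_mx (store_rv (store_mx m u d.1.1) l d.1.2) w d.2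
  end.

(* Every assignment counts for one operation on top of the arithmetic ones. *)
Fixpoint cost (c : cmd) (v : nenv) : nat :=
  match c with
  | Skip => 0
  | Assign _ _ e => (sops e).+1
  | Seqc c1 c2 => cost c1 v + cost c2 v
  | For x e c1 => \sum_(k < neval v e) cost c1 (bind v x k)
  | Eigh e _ _ _ | Svd e _ _ _ _ => neval v e ^ 3
  end%N.

(* Conventions for input and output: the size parameters are the initial values
   of the variables 0, 1, ...; the tensors are in array 1 (padded with zeros at
   the boundaries), a scalar parameter is in array 2, all other cells are 0;
   the result is in array 0. *)

Definition params (s : seq nat) : nenv := nth 0%N s.

Definition site_entry (R : realType) (I : Type) (n chi : nat)
    (A : train R I n chi) (i : nat) (s : I) (l r : nat) : R[i] :=
  if i == 0%N then entry 0 (lbound A s) l r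
  else if i == n.-1 then entry 0 (rbound A s) l r
  else if insub i.-1 is Some j then entry 0 (bulk A j s) l r else 0.

Definition mps_mem (R : realType) (n chi : nat) (A : mps R n chi) : mem R :=
  fun a ix =>
    match a, ix with
    | 1%N, [:: i; s; l; r] =>
        if (s < 2)%N then site_entry A i (s == 1%N) l r else 0
    | _, _ => 0
    end.

Definition mpo_mem (R : realType) (n chi : nat) (W : mpo R n chi) : mem R :=
  fun a ix =>
    match a, ix with
    | 1%N, [:: i; s; t; l; r] =>
        if (s < 2)%N && (t < 2)%N
        then site_entry W i (s == 1%N, t == 1%N) l r else 0
    | _, _ => 0
    end.

Definition with_scalar (R : realType) (m : mem R) (x : R) : mem R :=
  put m 2 [::] x%:C.

Definition output (R : realType) (S : dense_solver R) (c : cmd) (s : seq nat)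
    (m : mem R) : R[i] :=
  exec S c (params s) m 0%N [::].

(* Main.v *)
Require Import Defs.
From mathcomp Require Import all_boot all_order all_algebra.
From mathcomp Require Import complex.
From mathcomp Require Import all_classical all_reals exp.
From mathcomp Require Import ring lra zify.

(* Cutting the train between A and B factors the realignment matrix as R = L M with inner
   dimension chi in (i) and chi ^ 2 in (ii).  The Gram matrix L^* L is a sweep of transfer
   operators over A (in (ii) it is G (x) conj G with G of size chi); writing it as F^* F, the
   matrix R^* R = (F M)^* (F M) has the nonzero eigenvalues, with multiplicity, of
   (F M) (F M)^*, which is obtained by sweeping over B and, in (ii), over C.  As x |-> x ^ p
   vanishes at 0 for p <> 0, the moments and the trace norm are sums over the eigenvalues of
   that small matrix.

   For r_4 no eigenvalue is needed: with G and Gamma the Gram matrices of the blocks A and C,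
   M_b the product of the site matrices along b, and P_(b1,b2) = M_b1^* G M_b2, each entry of
   R^* R has the form tr (Gamma P_(b1,b2) Gamma P_(b1',b2')^* ), so r_4 is the sum of their
   squared moduli, a contraction of two tensors with four legs. *)

Set Implicit Arguments.
Unset Strict Implicit.
Unset Printing Implicit Defensive.

Import Order.TTheory GRing.Theory Num.Theory.

Local Open Scope ring_scope.
Local Open Scope complex_scope.
Local Open Scope sesquilinear_scope.

(** * Spectra of Gram matrices *)

(** Three constraints shape the argument. The product of the two block Gram matrices already has the
    right nonzero spectrum, but it is not Hermitian, and the eigensolver is specified on Hermitian
    matrices only; hence the symmetric form built from a factor F. The Gram matrix of A may be
    singular and programs cannot branch on data, so F is the square root of the eigenvalues times
    the adjoint of the eigenvectors, a formula with no inverse and no rank decision. Finally, the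
    solver is arbitrary, and its eigenvalues must be compared with those that the spectral theorem
    gives for an exponentially large matrix: only traces of positive powers are compared, and
    interpolation passes from power sums to real powers without matching eigenvalues one by one. *)

Lemma poly_interpolation (F : fieldType) (r : seq F) (g : F -> F) :
  uniq r -> exists p : {poly F}, {in r, forall x, p.[x] = g x}.
Proof.
elim: r => [|y r IH] /=; first by exists 0.
case/andP=> yr /IH[p pE]; pose w : {poly F} := \prod_(z <- r) ('X - z%:P).
have w_neq0 : w.[y] != 0 by rewrite -[_ == _]/(root w y) root_prod_XsubC.
(* Newton interpolation: a multiple of [w], which vanishes on [r], corrects the value at the new
   node [y]. *)
exists (p + ((g y - p.[y]) / w.[y]) *: w) => x; rewrite inE hornerD hornerZ.
case/predU1P=> [->|xr]; first by rewrite divfK // addrC subrK.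
have /eqP -> : root w x by rewrite root_prod_XsubC.
by rewrite mulr0 addr0 pE.
Qed.

(* Interpolate [f] on [0 :: s ++ t] by a polynomial; its constant term is 0. *)
Lemma eq_sum_of_power_sums (F : fieldType) (s t : seq F) (f : F -> F) :
    f 0 = 0 ->
    (forall k, \sum_(x <- s) x ^+ k.+1 = \sum_(x <- t) x ^+ k.+1) ->
  \sum_(x <- s) f x = \sum_(x <- t) f x.
Proof.
move=> f0 st; have [p pE] := poly_interpolation f (undup_uniq (0 :: s ++ t)).
have p0 : p`_0 = 0 by rewrite -horner_coef0 pE ?f0 // mem_undup mem_head.
have sumE u : {subset u <= s ++ t} ->
    \sum_(x <- u) f x = \sum_(i < size p) p`_i * \sum_(x <- u) x ^+ i.
  move=> u_st; under [RHS]eq_bigr do rewrite mulr_sumr.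
  rewrite exchange_big /=; apply: eq_big_seq => x /u_st xst.
  by rewrite -horner_coef pE // mem_undup inE xst orbT.
rewrite !sumE; last 2 first.
- by move=> x xt; rewrite mem_cat xt orbT.
- by move=> x xs; rewrite mem_cat xs.
by apply: eq_bigr => -[[|i] ?] _ /=; rewrite ?p0 ?mul0r ?st.
Qed.

Lemma big_row_val (F : nmodType) (T : Type) (D : nat) (d : 'rV[T]_D) (f : T -> F) :
  \sum_(x <- [seq d 0 i | i <- enum 'I_D]) f x = \sum_i f (d 0 i).
Proof. by rewrite big_map big_enum. Qed.

Lemma mxtrace_diagonalized_expr (F : fieldType) (D : nat) (P M : 'M[F]_D)
    (d : 'rV[F]_D) (k : nat) :
    P \in unitmx -> M = invmx P *m diag_mx d *m P ->
  \tr (M ^+ k) = \sum_i d 0 i ^+ k.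
Proof.
move=> Pu ->; have -> : (invmx P *m diag_mx d *m P) ^+ k =
    invmx P *m diag_mx (map_mx (fun x => x ^+ k) d) *m P.
  elim: k => [|k IH].
    rewrite expr0 (_ : map_mx _ d = const_mx 1) ?diag_const_mx ?mulmx1 ?mulVmx //.
    by apply/rowP => i; rewrite !mxE expr0.
  rewrite exprS IH -[LHS]/(_ *m _) !mulmxA mulmxK //; congr (_ *m _).
  rewrite -!mulmxA mulmx_diag; congr (_ *m diag_mx _).
  by apply/rowP => i; rewrite !mxE exprS.
rewrite -mulmxA mxtrace_mulC mulmxK // mxtrace_diag.
by apply: eq_bigr => i _; rewrite mxE.
Qed.

(** One has (X Y)^(k+1) = X (Y X)^k Y, and the trace is cyclic. Exponent 0 is left out: the traces
    would be [p] and [q], the two sizes differing by zero eigenvalues. *)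
Lemma mxtrace_mul_comm_expr (F : comNzRingType) (p q k : nat) (X : 'M[F]_(p, q))
    (Y : 'M[F]_(q, p)) :
  \tr ((X *m Y) ^+ k.+1) = \tr ((Y *m X) ^+ k.+1).
Proof.
have E : (X *m Y) ^+ k.+1 = X *m (Y *m X) ^+ k *m Y.
  elim: k => [|k IH]; first by rewrite expr0 mulmx1.
  by rewrite exprS IH [in RHS]exprS -[LHS]/(_ *m _) -![_ * _]/(_ *m _) !mulmxA.
by rewrite E -mulmxA mxtrace_mulC exprSr -mulmxA.
Qed.

Section Spectral.
Variable R : realType.
Local Notation C := R[i].
Local Notation toC := (map_mx (fun x : R => x%:C)).

Lemma hermsymmxP (D : nat) (M : 'M[C]_D) : reflect (M = M ^t*) (M \is hermsymmx).
Proof. by apply: (iffP (is_hermitianmxP _ _ _)); rewrite expr0 scale1r. Qed.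

Lemma adjmx_mul (p q r : nat) (X : 'M[C]_(p, q)) (Y : 'M[C]_(q, r)) :
  (X *m Y) ^t* = Y ^t* *m X ^t*.
Proof. by rewrite trmx_mul map_mxM. Qed.

Lemma hermsymmx_mul_adj (p q : nat) (X : 'M[C]_(p, q)) : X *m X ^t* \is hermsymmx.
Proof. by apply/hermsymmxP; rewrite adjmx_mul trmxCK. Qed.

Lemma mxtrace_hpow (D : nat) (H : 'M[C]_D) (p : R) :
  \tr (hpow H p) = \sum_i ((complex.Re (spectral_diag H 0 i)) `^ p)%:C.
Proof.
rewrite /hpow -mulmxA mxtrace_mulC mulmxK ?unitarymx_unit ?spectral_unitarymx //.
by rewrite mxtrace_diag; apply: eq_bigr => i _; rewrite mxE.
Qed.

Lemma mxtrace_hermsym_expr (D : nat) (H : 'M[C]_D) (k : nat) :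
  H \is hermsymmx -> \tr (H ^+ k) = \sum_i spectral_diag H 0 i ^+ k.
Proof.
move=> /hermitian_normalmx /orthomx_spectralP; apply: mxtrace_diagonalized_expr.
by rewrite unitarymx_unit ?spectral_unitarymx.
Qed.

(** The two sides come from unrelated decompositions of matrices of different sizes. Their positive
    power sums are traces, equal by cyclicity, and [e != 0] makes the power vanish at the surplus
    zero eigenvalues. *)
Lemma mxtrace_hpow_eigh (p q : nat) (Z : 'M[C]_(p, q)) d (e : R) :
    e != 0 -> is_eigh (Z *m Z ^t*) d ->
  \tr (hpow (Z ^t* *m Z) e) = \sum_i ((d.2 0 i) `^ e)%:C.
Proof.
move=> e0 [Uu ZE]; rewrite mxtrace_hpow.
pose f (x : C) : C := ((complex.Re x) `^ e)%:C.
rewrite -(big_row_val _ f); transitivity (\sum_i f (toC d.2 0 i)); last first.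
  by apply: eq_bigr => i _; rewrite mxE.
rewrite -big_row_val; apply: eq_sum_of_power_sums => [|k].
  by rewrite /f /= powR0.
rewrite !(big_row_val _ (fun x : C => x ^+ k.+1)) -mxtrace_hermsym_expr; last first.
  by rewrite -{2}[Z]trmxCK hermsymmx_mul_adj.
rewrite mxtrace_mul_comm_expr ZE.
have Uu' : d.1 ^t* \is unitarymx by rewrite trmxC_unitary.
have invU : invmx (d.1 ^t*) = d.1 by rewrite (invmx_unitary Uu') trmxCK.
by rewrite (mxtrace_diagonalized_expr k.+1 (unitarymx_unit Uu') (d := toC d.2)) ?invU.
Qed.

(** The real power of exponent 2 is the square when the base is nonnegative; diagonalizing a Gram
    matrix shows each eigenvalue to be a sum of squared moduli. *)
Lemma mxtrace_hpow2 (p q : nat) (Z : 'M[C]_(p, q)) :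
  \tr (hpow (Z ^t* *m Z) 2) = \tr ((Z ^t* *m Z) *m (Z ^t* *m Z)).
Proof.
have Hh : Z ^t* *m Z \is hermsymmx by rewrite -{2}[Z]trmxCK hermsymmx_mul_adj.
rewrite -[_ *m (_ *m Z)]/((Z ^t* *m Z) ^+ 2) mxtrace_hermsym_expr // mxtrace_hpow.
set sd := spectral_diag _; set P := spectralmx (Z ^t* *m Z).
have Pu : P \is unitarymx by apply: spectral_unitarymx.
have sdE : diag_mx sd = (Z *m P ^t*) ^t* *m (Z *m P ^t*).
  have /hermitian_normalmx /orthomx_spectralP ZE := Hh.
  rewrite adjmx_mul trmxCK !mulmxA -[P *m _ *m _]mulmxA ZE -/sd -/P.
  rewrite invmx_unitary // !mulmxA (unitarymxP Pu) mul1mx -mulmxA.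
  by rewrite (unitarymxP Pu) mulmx1.
apply: eq_bigr => i _.
have sd_ge0 : 0 <= sd 0 i.
  have /matrixP/(_ i i) := sdE; rewrite !mxE eqxx mulr1n => ->.
  by apply: sumr_ge0 => j _; rewrite !mxE mulrC mul_conjC_ge0.
case: (sd 0 i) sd_ge0 => a b; rewrite lecE /= => /andP[/eqP b0 a0].
rewrite powR_mulrn // b0 /= !expr2; apply/eqP; rewrite eq_complex /=.
by rewrite !mulr0 !mul0r !subr0 !addr0 !eqxx.
Qed.

(** [is_eigh] says nothing about signs. That the square roots multiply back to the eigenvalues comes
    from the matrix being a Gram matrix, however many rows [L] has. *)
Lemma eigh_sqrt_factor (D p : nat) (L : 'M[C]_(p, D)) d :
    is_eigh (L ^t* *m L) d ->
  let F := \matrix_(i, j) (((d.2 0 i) `^ 2^-1)%:C * (d.1 j i)^*%R) in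
  F ^t* *m F = L ^t* *m L.
Proof.
move=> [Uu LE] F.
have dE : diag_mx (toC d.2) = (L *m d.1) ^t* *m (L *m d.1).
  have Uu' : d.1 ^t* *m d.1 = 1%:M.
    by have := Uu; rewrite -trmxC_unitary => /unitarymxP; rewrite trmxCK.
  rewrite adjmx_mul !mulmxA -[_ *m L]mulmxA LE !mulmxA Uu' mul1mx.
  by rewrite -mulmxA Uu' mulmx1.
have d_ge0 i : 0 <= d.2 0 i.
  rewrite -lecR; have /matrixP/(_ i i) := dE; rewrite !mxE eqxx mulr1n => ->.
  by apply: sumr_ge0 => j _; rewrite !mxE mulrC mul_conjC_ge0.
rewrite LE; apply/matrixP => i j; rewrite !mxE; apply: eq_bigr => k _.
rewrite mul_mx_diag !mxE rmorphM /= conjCK.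
have -> : (((d.2 0 k) `^ 2^-1)%:C : C)^*%R = ((d.2 0 k) `^ 2^-1)%:C.
  by apply/CrealP; apply/complex_realP; exists ((d.2 0 k) `^ 2^-1).
have half2 : 2^-1 + 2^-1 = 1 :> R by lra.
rewrite mulrACA -rmorphM /= -powRD half2 ?oner_eq0 //.
by rewrite powRr1 // mulrCA mulrA.
Qed.

End Spectral.

(** * Matrix products and transfer operators *)

Lemma big_tuple_cons (V : nmodType) (I : finType) n (f : seq I -> V) :
  \sum_(t : n.+1.-tuple I) f t = \sum_s \sum_(t : n.-tuple I) f (s :: t).
Proof.
rewrite pair_big /=.
rewrite (reindex (fun p : I * n.-tuple I => cons_tuple p.1 p.2)) //=.
exists (fun t => (thead t, behead_tuple t)) => [[s t] _|t _] /=.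
  by congr pair; apply: val_inj.
by rewrite [RHS]tuple_eta; apply: val_inj.
Qed.

Lemma big_tuple0 (V : nmodType) (I : finType) (f : seq I -> V) :
  \sum_(t : 0.-tuple I) f t = f [::].
Proof.
rewrite (bigD1 [tuple]) //= big1 ?addr0 // => t.
by move=> /eqP[]; exact: tuple0.
Qed.

Lemma big_tuple_rcons (V : nmodType) (I : finType) n (f : seq I -> V) :
  \sum_(t : n.+1.-tuple I) f t = \sum_s \sum_(t : n.-tuple I) f (rcons t s).
Proof.
elim: n f => [|n IH] f.
  rewrite big_tuple_cons; apply: eq_bigr => s _.
  by rewrite (big_tuple0 (fun t => f (s :: t))) (big_tuple0 (fun t => f (rcons t s))).
rewrite big_tuple_cons (eq_bigr _ (fun s _ => IH (fun t => f (s :: t)))).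
rewrite exchange_big /=; apply: eq_bigr => s _.
by rewrite (big_tuple_cons _ (fun t => f (rcons t s))).
Qed.

Lemma big_tuple_zip (V : nmodType) (I J : finType) n (f : seq (I * J) -> V) :
  \sum_(x : n.-tuple I * n.-tuple J) f (zip x.1 x.2) = \sum_(t : n.-tuple (I * J)) f t.
Proof.
rewrite [RHS](reindex (fun x : n.-tuple I * n.-tuple J => zip_tuple x.1 x.2)) //=.
exists (fun t => (map_tuple fst t, map_tuple snd t)) => [[a b] _|t _] /=.
  congr pair; apply: val_inj => /=.
    by rewrite -/unzip1 unzip1_zip // !size_tuple.
  by rewrite -/unzip2 unzip2_zip // !size_tuple.
by apply: val_inj; rewrite /= -/unzip1 -/unzip2 zip_unzip.
Qed.

Section MatrixProduct.
Variables (R : realType) (I : finType) (c : nat).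
Local Notation C := R[i].
Local Notation M := 'M[C]_c.+1.
Variable T : nat -> I -> M.

Fixpoint mprod (i : nat) (w : seq I) : M :=
  if w is s :: w' then T i s *m mprod i.+1 w' else 1%:M.

Lemma mprod_cat i w1 w2 : mprod i (w1 ++ w2) = mprod i w1 *m mprod (i + size w1) w2.
Proof.
elim: w1 i => [|s w IH] i /=; first by rewrite mul1mx addn0.
by rewrite IH addSnnS mulmxA.
Qed.

Lemma mprod_rcons i w s : mprod i (rcons w s) = mprod i w *m T (i + size w) s.
Proof. by rewrite -cats1 mprod_cat /= mulmx1. Qed.

(* Iterated completely positive map with Kraus operators [A i s]. *)
Fixpoint sweep (A : nat -> I -> M) (X : M) (n : nat) : M :=
  if n is n'.+1 then \sum_s A n' s *m sweep A X n' *m (A n' s) ^t* else X.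

Lemma sweep_left X n : sweep (fun i s => (T i s) ^t*) X n =
  \sum_(w : n.-tuple I) (mprod 0 w) ^t* *m X *m mprod 0 w.
Proof.
elim: n => [|n IH] /=.
  rewrite (big_tuple0 (fun w => (mprod 0 w) ^t* *m X *m mprod 0 w)) /=.
  by rewrite trmx1 map_mx1 mul1mx mulmx1.
rewrite (big_tuple_rcons _ (fun w => (mprod 0 w) ^t* *m X *m mprod 0 w)).
apply: eq_bigr => s _; rewrite IH mulmx_sumr mulmx_suml; apply: eq_bigr => w _.
by rewrite mprod_rcons size_tuple adjmx_mul trmxCK !mulmxA.
Qed.

(** Step [i] absorbs site [N - 1 - i], so words grow at their front, unlike in [sweep_left]; the
    bound keeps the truncated subtractions exact. *)
Lemma sweep_right N X n : (n <= N)%N -> sweep (fun i s => T (N - 1 - i) s) X n =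
  \sum_(w : n.-tuple I) mprod (N - n) w *m X *m (mprod (N - n) w) ^t*.
Proof.
elim: n => [|n IH] /= nN.
  rewrite (big_tuple0 (fun w => mprod _ w *m X *m (mprod _ w) ^t*)) /=.
  by rewrite trmx1 map_mx1 mul1mx mulmx1.
rewrite (big_tuple_cons _ (fun w => mprod _ w *m X *m (mprod _ w) ^t*)).
apply: eq_bigr => s _; rewrite (IH (ltnW nN)) mulmx_sumr mulmx_suml.
have -> : (N - 1 - n = N - n.+1)%N by lia.
have -> : (N - n = (N - n.+1).+1)%N by lia.
by apply: eq_bigr => w _; rewrite /= adjmx_mul !mulmxA.
Qed.

End MatrixProduct.

Section Train.
Variables (R : realType) (I : Type) (n c : nat) (A : train R I n c.+1).
Local Notation C := R[i].

(** The boundary row and column vectors become row 0 and column 0 of square matrices padded with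
    zeros: all sites look alike, and the value of the train is the entry (0, 0) of a plain
    product. *)
Definition site_mx (i : nat) (s : I) : 'M[C]_c.+1 :=
  \matrix_(l, r) site_entry A i s l r.

End Train.


Lemma entry_ord (R : realType) p q z (M : 'M[R[i]]_(p, q)) (i : 'I_p) (j : 'I_q) :
  entry z M i j = M i j.
Proof. by rewrite /entry !valK. Qed.

Lemma train_val_mprod (R : realType) (I : finType) n c (A : train R I n c.+1) f :
  (1 < n)%N -> train_val A f = mprod (site_mx A) 0 (mkseq f n) 0 0.
Proof.
case: n A => [|[|n]] // A _.
have iotaSr k : iota 1 k.+1 = rcons (iota 1 k) k.+1.
  by have := iotaD 1 k 1; rewrite /= addn1 cats1 add1n.
have -> : mkseq f n.+2 = f 0%N :: rcons (map f (iota 1 n)) (f n.+1).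
  by rewrite /mkseq -[iota 0 _]/(0%N :: iota 1 n.+1) iotaSr map_cons map_rcons.
rewrite /= mprod_rcons size_map size_iota add1n /train_val mulmxA.
have bulkE k :
    mprod (site_mx A) 1 (map f (iota 1 k)) =
    \prod_(i < k) site_mx A i.+1 (f i.+1).
  elim: k => [|k IH]; first by rewrite big_ord0.
  rewrite iotaSr map_rcons mprod_rcons big_ord_recr /=.
  by rewrite IH size_map size_iota add1n.
have mulmx_entry (X Y Z : 'M[R[i]]_c.+1) : (X *m Y *m Z) 0 0 = (row 0 X *m Y *m col 0 Z) 0 0.
  by rewrite -row_mul !mxE; apply: eq_bigr => j _; rewrite !mxE.
rewrite mulmx_entry; congr ((_ *m _ *m _) _ _).
- by apply/rowP => j; rewrite !mxE /site_entry (entry_ord _ _ ord0).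
- have nE : (n.+2 - 2 = n)%N by lia.
  rewrite -[X in iota 1 X]nE bulkE.
  apply: eq_bigr => i _.
  apply/matrixP => l r; rewrite !mxE /site_entry /=.
  have il : (i < n)%N by rewrite -{2}nE.
  by rewrite eqSS (ltn_eqF il) valK entry_ord.
- apply/colP => j; rewrite !mxE /site_entry /= eqxx.
  by rewrite (entry_ord _ _ _ ord0).
Qed.

(** * Realignment *)

Section Realign.
Variable R : realType.
Local Notation C := R[i].

Lemma mxval_mxof (S T : finType) (f : S -> T -> C) s t : mxval (mxof f) s t = f s t.
Proof. by rewrite /mxval mxE !enum_rankK. Qed.

Lemma big_enum_val_ord (V : nmodType) (J : finType) (f : J -> V) :
  \sum_(i < #|J|) f (enum_val i) = \sum_j f j.
Proof. by rewrite -(big_enum_val f); apply: eq_bigl. Qed.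

Lemma mxof_adj_mul (S T : finType) (f : S -> T -> C) :
  (mxof f) ^t* *m mxof f = mxof (fun t t' => \sum_s (f s t)^*%R * f s t').
Proof.
apply/matrixP => i j; rewrite !mxE -[RHS]big_enum_val_ord; apply: eq_bigr => k _.
by rewrite !mxE.
Qed.

Lemma mxtrace_mxof_sqr (T : finType) (f : T -> T -> C) :
  \tr (mxof f *m mxof f) = \sum_t \sum_t' f t t' * f t' t.
Proof.
rewrite /mxtrace -[RHS]big_enum_val_ord; apply: eq_bigr => i _.
by rewrite mxE -[RHS]big_enum_val_ord; apply: eq_bigr => j _; rewrite !mxE.
Qed.

Lemma realign_mxof nA nB f :
  realign nA nB (mxof f) = mxof (fun (a : nA.-tuple bool * nA.-tuple bool)
      (b : nB.-tuple bool * nB.-tuple bool) =>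
    f [tuple of a.1 ++ b.1] [tuple of a.2 ++ b.2] : C).
Proof. by apply/matrixP => i j; rewrite !mxE mxval_mxof. Qed.

Definition stack (J : finType) q (u : J -> 'rV[C]_q) : 'M[C]_(#|J|, q) :=
  \matrix_i u (enum_val i).

Lemma stack_gram (J : finType) q (u : J -> 'rV[C]_q) :
  (stack u) ^t* *m stack u = \sum_j (u j) ^t* *m u j.
Proof.
apply/matrixP => k l; rewrite summxE !mxE -[RHS]big_enum_val_ord; apply: eq_bigr => i _.
by rewrite !mxE big_ord1 !mxE.
Qed.

Lemma gram_rows p q (F : 'M[C]_(p, q)) : F ^t* *m F = \sum_i (row i F) ^t* *m row i F.
Proof.
apply/matrixP => k l; rewrite summxE !mxE; apply: eq_bigr => i _.
by rewrite !mxE big_ord1 !mxE.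
Qed.

Lemma conj_mx11 (X : 'M[C]_1) : (X 0 0)^*%R = (X ^t*) 0 0.
Proof. by rewrite !mxE. Qed.

(* Only the Gram matrix of the rows matters: the exponentially many rows of block A may
   be replaced by those of any factor of it. *)
Lemma sum_pair_rows (J : finType) q (u : J -> 'rV[C]_q) (X Y G : 'M[C]_q) :
    \sum_j (u j) ^t* *m u j = G ->
  \sum_j \sum_j' ((u j *m X *m (u j') ^t*) 0 0)^*%R * (u j *m Y *m (u j') ^t*) 0 0
  = \tr (X ^t* *m G *m Y *m G).
Proof.
move=> <-; rewrite exchange_big mulmx_sumr raddf_sum; apply: eq_bigr => j' _.
rewrite mulmx_sumr !mulmx_suml raddf_sum; apply: eq_bigr => j _.
transitivity (\tr (u j' *m (X ^t* *m ((u j) ^t* *m u j) *m Y *m (u j') ^t*))).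
  rewrite conj_mx11 !adjmx_mul trmxCK.
  have mul11 (P Q : 'M[C]_1) : P 0 0 * Q 0 0 = (P *m Q) 0 0 by rewrite mxE big_ord1.
  by rewrite mul11 /mxtrace big_ord1 !mulmxA.
by rewrite mxtrace_mulC /= !mulmxA.
Qed.

Variable c : nat.
Local Notation M := 'M[C]_c.+1.
Local Notation E := (delta_mx 0 0 : M).

(** The sweeps start from the projector onto the boundary index 0. As it has rank one, a block
    product is seen only through its row 0 on the left and its column 0 on the right, so a sweep
    yields the Gram matrix of these exponentially many vectors. *)
Lemma deltaE : E = delta_mx 0 0 *m (delta_mx 0 0 : 'cV[C]_c.+1) ^t*.
Proof.
by rewrite trmx_delta map_delta_mx mul_delta_mx.
Qed.

Lemma adj_mul_delta_mul (A : M) : A ^t* *m E *m A = (row 0 A) ^t* *m row 0 A.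
Proof.
rewrite deltaE trmx_delta map_delta_mx rowE adjmx_mul trmx_delta map_delta_mx.
by rewrite !mulmxA.
Qed.

Lemma mul_delta_mul_adj (A : M) : A *m E *m A ^t* = col 0 A *m (col 0 A) ^t*.
Proof. by rewrite deltaE colE adjmx_mul !mulmxA. Qed.

Section Sweeps.
Variables (I : finType) (T : nat -> I -> M).

Lemma sweep_left_gram n : sweep (fun i s => (T i s) ^t*) E n =
  \sum_(w : n.-tuple I) (row 0 (mprod T 0 w)) ^t* *m row 0 (mprod T 0 w).
Proof. by rewrite sweep_left; apply: eq_bigr => w _; rewrite adj_mul_delta_mul. Qed.

Lemma sweep_right_gram N n : (n <= N)%N -> sweep (fun i s => T (N - 1 - i) s) E n =
  \sum_(w : n.-tuple I) col 0 (mprod T (N - n) w) *m (col 0 (mprod T (N - n) w)) ^t*.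
Proof. by move=> nN; rewrite sweep_right //; apply: eq_bigr => w _; rewrite mul_delta_mul_adj. Qed.

(** The tall factor that [eigh_sqrt_factor] asks for is the [stack] of the first rows of all block
    products; it occurs in the proof only, never in a program. *)
Lemma eigh_sweep_factor n d :
    is_eigh (sweep (fun i s => (T i s) ^t*) E n) d ->
  let F := \matrix_(i, j) (((d.2 0 i) `^ 2^-1)%:C * (d.1 j i)^*%R) in
  F ^t* *m F = sweep (fun i s => (T i s) ^t*) E n.
Proof. by rewrite sweep_left_gram -stack_gram; apply: eigh_sqrt_factor. Qed.

Lemma sweep_left_herm n : sweep (fun i s => (T i s) ^t*) E n \is hermsymmx.
Proof.
rewrite sweep_left_gram -stack_gram -[X in _ *m X]trmxCK; exact: hermsymmx_mul_adj.
Qed.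

Lemma sweep_right_adj N n : (n <= N)%N ->
  (sweep (fun i s => T (N - 1 - i) s) E n) ^t* = sweep (fun i s => T (N - 1 - i) s) E n.
Proof.
move=> nN; rewrite sweep_right_gram // raddf_sum raddf_sum.
by apply: eq_bigr => w _; rewrite -[LHS]/((_ *m _) ^t*) adjmx_mul trmxCK.
Qed.

End Sweeps.

(** * Realignment of a matrix product operator *)

Section Mpo.
Variables (nA nB : nat) (W : mpo R (nA + nB) c.+1).
Hypothesis n_gt1 : (1 < nA + nB)%N.
Let T := site_mx W.

Lemma mpo_mxE : mpo_mx W = mxof (fun s t : (nA + nB).-tuple bool => mprod T 0 (zip s t) 0 0).
Proof.
congr mxof; apply/funext => s; apply/funext => t; rewrite train_val_mprod //.
congr (mprod _ _ _ _ _); apply: (@eq_from_nth _ (false, false)).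
  by rewrite size_mkseq size_zip !size_tuple minnn.
by move=> i; rewrite size_mkseq => il; rewrite nth_mkseq // nth_zip ?size_tuple.
Qed.

(** As [stack u] and [F] have the same Gram matrix, so have [Q] and [F *m (stack w)^T], although [Q]
    has one row for each pair of words on A. *)
Lemma mpo_hpow (F : M) d (e : R) : e != 0 ->
    F ^t* *m F = sweep (fun i s => (T i s) ^t*) E nA ->
    is_eigh (F *m sweep (fun i s => T (nA + nB - 1 - i)%N s) E nB *m F ^t*) d ->
  let Q := realign nA nB (mpo_mx W) in
  \tr (hpow (Q ^t* *m Q) e) = \sum_i ((d.2 0 i) `^ e)%:C.
Proof.
move=> e0 FG.
pose u (x : nA.-tuple bool * nA.-tuple bool) := row 0 (mprod T 0 (zip x.1 x.2)).
pose w (x : nB.-tuple bool * nB.-tuple bool) := (col 0 (mprod T nA (zip x.1 x.2)))^T.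
have uG : (stack u) ^t* *m stack u = F ^t* *m F.
  rewrite FG stack_gram sweep_left_gram -(big_tuple_zip _
    (fun t => (row 0 (mprod T 0 t)) ^t* *m row 0 (mprod T 0 t))).
  by apply: eq_bigr.
have wH : (stack w)^T *m (stack w)^T ^t* = sweep (fun i s => T (nA + nB - 1 - i)%N s) E nB.
  rewrite sweep_right_gram ?leq_addl // addnK -(big_tuple_zip _
    (fun t => col 0 (mprod T nA t) *m (col 0 (mprod T nA t)) ^t*)).
  apply/matrixP => k l; rewrite summxE mxE -[RHS]big_enum_val_ord.
  by apply: eq_bigr => i _; rewrite !mxE big_ord1 !mxE.
rewrite -wH mulmxA -[X in is_eigh X]mulmxA -adjmx_mul => Kd Q.
rewrite -(mxtrace_hpow_eigh e0 Kd) adjmx_mul !mulmxA -[_ *m F ^t* *m F]mulmxA -uG.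
suff -> : Q = stack u *m (stack w)^T.
  by rewrite adjmx_mul !mulmxA.
rewrite /Q mpo_mxE realign_mxof; apply/matrixP => i j; rewrite !mxE.
(* Realignment groups the ket and bra bits of the same block, so the zipped word splits at the
   cut. *)
rewrite zip_cat ?size_tuple // mprod_cat size_zip !size_tuple minnn mxE.
by apply: eq_bigr => k _; rewrite !mxE.
Qed.

End Mpo.

(* Four-leg tensor [sum_j P j (x) conj (P j)]; all four-leg tensors swept in part (ii)
   have this form. *)
Definition tens (J : finType) (P : J -> M) (x y z w : 'I_c.+1) : C :=
  \sum_j P j x z * (P j y w)^*%R.

(** Contracting the legs [x] and [z] gives the Hilbert-Schmidt product of [P j] and [P' j'];
    contracting [y] and [w] gives its conjugate. *)
Lemma tens_inner (J J' : finType) (P : J -> M) (P' : J' -> M) :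
  \sum_x \sum_y \sum_z \sum_w tens P x y z w * (tens P' x y z w)^*%R =
  \sum_j \sum_j' \tr (P j *m (P' j') ^t*) * (\tr (P j *m (P' j') ^t*))^*%R.
Proof.
have trE j j' : \tr (P j *m (P' j') ^t*) = \sum_x \sum_z P j x z * (P' j' x z)^*%R.
  by apply: eq_bigr => x _; rewrite mxE; apply: eq_bigr => z _; rewrite !mxE.
transitivity (\sum_x \sum_y \sum_z \sum_w \sum_j \sum_j'
    (P j x z * (P j y w)^*%R) * (P' j' x z * (P' j' y w)^*%R)^*%R).
  apply: eq_bigr => x _; apply: eq_bigr => y _; apply: eq_bigr => z _; apply: eq_bigr => w _.
  rewrite rmorph_sum mulr_suml; apply: eq_bigr => j _.
  by rewrite mulr_sumr.
have pull (K : finType) (f : 'I_c.+1 -> 'I_c.+1 -> 'I_c.+1 -> 'I_c.+1 -> K -> C) :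
    \sum_x \sum_y \sum_z \sum_w \sum_k f x y z w k =
    \sum_k \sum_x \sum_y \sum_z \sum_w f x y z w k.
  rewrite [RHS]exchange_big; apply: eq_bigr => x _.
  rewrite [RHS]exchange_big; apply: eq_bigr => y _.
  rewrite [RHS]exchange_big; apply: eq_bigr => z _.
  by rewrite [RHS]exchange_big.
rewrite pull; apply: eq_bigr => j _; rewrite pull; apply: eq_bigr => j' _.
rewrite trE rmorph_sum mulr_suml; apply: eq_bigr => x _.
rewrite mulr_sumr; apply: eq_bigr => y _.
rewrite rmorph_sum mulr_suml; apply: eq_bigr => z _.
rewrite mulr_sumr; apply: eq_bigr => w _.
by rewrite !rmorphM /= !conjCK; ring.
Qed.

(** [hi] and [lo] decode, in row-major order, the index of a matrix of size chi^2; [pair_gram]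
    writes to the matching addresses. *)
Definition hi (i : 'I_(c.+1 * c.+1)) : 'I_c.+1 := inord (i %/ c.+1).
Definition lo (i : 'I_(c.+1 * c.+1)) : 'I_c.+1 := inord (i %% c.+1).

Lemma big_hi_lo (V : nmodType) (f : 'I_c.+1 -> 'I_c.+1 -> V) :
  \sum_i f (hi i) (lo i) = \sum_p \sum_q f p q.
Proof.
have lt (p : 'I_c.+1 * 'I_c.+1) : (p.1 * c.+1 + p.2 < c.+1 * c.+1)%N.
  by case: p => p q /=; have := ltn_ord p; have := ltn_ord q; nia.
have ltd (i : 'I_(c.+1 * c.+1)) : (i %/ c.+1 < c.+1)%N by rewrite ltn_divLR.
rewrite pair_big /= (reindex (fun i => (hi i, lo i))) //=.
exists (fun p => Ordinal (lt p)) => [i _|[p q] _] /=.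
  by apply: val_inj; rewrite /= !inordK ?ltn_pmod // -divn_eq.
by congr pair; apply: val_inj; rewrite /= inordK ?modnMDl ?divnMDl ?divn_small ?modn_small ?addn0.
Qed.

(** * Realignment of a reduced pure state *)

Section Mps.
Variables (nA nB nC : nat) (A : mps R (nA + nB + nC) c.+1).
Hypothesis n_gt1 : (1 < nA + nB + nC)%N.
Let T := site_mx A.
Let n := (nA + nB + nC)%N.
Let G := sweep (fun i s => (T i s) ^t*) E nA.
Let Gam := sweep (fun i s => T (n - 1 - i)%N s) E nC.
Let u (a : nA.-tuple bool) := row 0 (mprod T 0 a).
Let X (b : nB.-tuple bool * nB.-tuple bool) :=
  mprod T nA b.1 *m Gam *m (mprod T nA b.2) ^t*.
Let Q := realign nA nB (reduced (mps_ket A)).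

Lemma mps_ketE (s : (nA + nB + nC).-tuple bool) : mps_ket A s = mprod T 0 s 0 0.
Proof.
rewrite /mps_ket train_val_mprod //; congr (mprod _ _ _ _ _).
by have := mkseq_nth false s; rewrite size_tuple.
Qed.

(** Summing over the traced-out sites glues the ket product to the adjoint bra product through
    [Gam]; the words on A stay outermost on both sides, which leaves a sesquilinear form in the rows
    [u]. *)
Lemma mps_realignE : Q = mxof (fun a b => (u a.1 *m X b *m (u a.2) ^t*) 0 0).
Proof.
rewrite /Q /reduced realign_mxof; congr mxof.
apply/funext => -[a a']; apply/funext => -[b b'] /=; rewrite /X /=.
have -> : Gam = \sum_(w : nC.-tuple bool)
    col 0 (mprod T (nA + nB) w) *m (col 0 (mprod T (nA + nB) w)) ^t*.
  by rewrite /Gam sweep_right_gram ?leq_addl // /n addnK.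
rewrite mulmx_sumr mulmx_suml mulmx_sumr mulmx_suml summxE.
apply: eq_bigr => w _; rewrite !mps_ketE /=.
have entryE (a0 : nA.-tuple bool) (b0 : nB.-tuple bool) :
    mprod T 0 ((a0 ++ b0) ++ w) 0 0 =
    (u a0 *m mprod T nA b0 *m col 0 (mprod T (nA + nB) w)) 0 0.
  rewrite !mprod_cat !size_cat !size_tuple add0n /u -row_mul !mxE.
  by apply: eq_bigr => k _; rewrite !mxE.
rewrite !entryE conj_mx11 !adjmx_mul.
have mul11 (P P' : 'M[C]_1) : P 0 0 * P' 0 0 = (P *m P') 0 0 by rewrite mxE big_ord1.
by rewrite mul11 !mulmxA.
Qed.

Lemma mps_realign_gram : Q ^t* *m Q = mxof (fun b b' => \tr ((X b) ^t* *m G *m X b' *m G)).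
Proof.
rewrite mps_realignE mxof_adj_mul; congr mxof; apply/funext => b; apply/funext => b'.
rewrite -(sum_pair_rows (u := u)) ?pair_bigA //.
by rewrite /G sweep_left_gram.
Qed.

(** [sum_pair_rows] is applied in both directions: from the rows [u] to [G], then back from [G] to
    the rows of [F]. This leaves a matrix [Z] with one row per pair of rows of [F], and only [G], of
    size chi, has to be factored. *)
Lemma mps_hpow (F : M) (K : 'M[C]_(c.+1 * c.+1)) d (e : R) : e != 0 ->
    F ^t* *m F = G ->
    (forall i j, K i j = \sum_b (F *m X b *m F ^t*) (hi i) (lo i) *
                               ((F *m X b *m F ^t*) (hi j) (lo j))^*%R) ->
  K \is hermsymmx /\
  (is_eigh K d -> \tr (hpow (Q ^t* *m Q) e) = \sum_i ((d.2 0 i) `^ e)%:C).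
Proof.
move=> e0 FG KE.
pose Z : 'M[C]_(c.+1 * c.+1, #|{: nB.-tuple bool * nB.-tuple bool}|) :=
  \matrix_(i, j) (F *m X (enum_val j) *m F ^t*) (hi i) (lo i).
have -> : K = Z *m Z ^t*.
  apply/matrixP => i j; rewrite KE mxE -[LHS]big_enum_val_ord.
  by apply: eq_bigr => k _; rewrite !mxE.
split; first exact: hermsymmx_mul_adj.
move=> /(mxtrace_hpow_eigh e0) <-; congr (\tr (hpow _ e)).
have ZE k j : Z k j = (F *m X (enum_val j) *m F ^t*) (hi k) (lo k) by rewrite mxE.
rewrite mps_realign_gram; apply/matrixP => i j; rewrite mxE [RHS]mxE -FG.
rewrite (gram_rows F) -(sum_pair_rows (u := fun p => row p F)) // -big_hi_lo.
apply: eq_bigr => k _.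
have -> : (Z ^t*) i k = (Z k i)^*%R by rewrite 2!mxE.
have rowE Y p q : (F *m Y *m F ^t*) p q = (row p F *m Y *m (row q F) ^t*) 0 0.
  rewrite -row_mul !mxE; apply: eq_bigr => l _; by rewrite !mxE.
by rewrite !ZE (rowE (X _)) (rowE (X _)).
Qed.

(** Expanding both entries of F X F^* over the bond next to B, the sums over the two words of [b]
    separate: one goes with [Gam], the other without. Each is a tensor obtained by a sweep over B;
    joining them has four free and two summed indices, hence chi^6. *)
Lemma mps_gram_entry (F : M) p p' q q' :
  let N (b : nB.-tuple bool) := F *m mprod T nA b in
  \sum_m \sum_l tens (fun b => N b *m Gam) p q m l * (tens (fun b => (N b)^T) m l p' q')^*%R
  = \sum_b (F *m X b *m F ^t*) p p' * ((F *m X b *m F ^t*) q q')^*%R.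
Proof.
move=> N.
have XE b b' p0 q0 : (F *m X (b, b') *m F ^t*) p0 q0 =
    \sum_m (N b *m Gam) p0 m * (N b' q0 m)^*%R.
  rewrite /X /= -!mulmxA -adjmx_mul !mulmxA mxE; apply: eq_bigr => m _.
  by rewrite !mxE.
rewrite -(pair_bigA _ (fun b b' => (F *m X (b, b') *m F ^t*) p p' *
  ((F *m X (b, b') *m F ^t*) q q')^*%R)) /=.
under eq_bigr do under eq_bigr do rewrite /tens rmorph_sum mulr_suml.
under [RHS]eq_bigr do under eq_bigr do rewrite !XE rmorph_sum mulr_suml.
under eq_bigr do rewrite exchange_big /=.
rewrite exchange_big /=; apply: eq_bigr => b _.
under eq_bigr do under eq_bigr do rewrite mulr_sumr.
under eq_bigr do rewrite exchange_big /=.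
rewrite exchange_big /=; apply: eq_bigr => b' _.
apply: eq_bigr => m _; rewrite mulr_sumr; apply: eq_bigr => l _.
by rewrite !mxE !rmorphM /= !conjCK; ring.
Qed.

(** The realigned Gram matrix is Hermitian, so opposite entries multiply to a squared modulus.
    Exchanging [b1'] and [b2] then turns the sum over pairs (b1, b1'), (b2, b2') into one over (b1,
    b2), (b1', b2'), where the two arguments of the trace depend on separate pairs and [tens_inner]
    applies. *)
Lemma mps_moment4 :
  let P (b : nB.-tuple bool * nB.-tuple bool) :=
    (mprod T nA b.1) ^t* *m G *m mprod T nA b.2 in
  \tr (hpow (Q ^t* *m Q) 2) =
  \sum_x \sum_y \sum_z \sum_w
    tens (fun b => Gam *m P b *m Gam) x y z w * (tens P x y z w)^*%R.
Proof.
have Gh : G ^t* = G by have /hermsymmxP := sweep_left_herm T nA.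
have Gamh : Gam ^t* = Gam by apply: sweep_right_adj; exact: leq_addl.
have cyc (a a' b b' g h : M) : g ^t* = g -> h ^t* = h ->
    \tr ((a *m h *m a' ^t*) ^t* *m g *m (b *m h *m b' ^t*) *m g) =
    \tr (h *m (a ^t* *m g *m b) *m h *m (a' ^t* *m g *m b') ^t*).
  move=> gh hh; rewrite !adjmx_mul !trmxCK gh hh.
  transitivity (\tr (a' *m (h *m a ^t* *m g *m b *m h *m b' ^t* *m g))).
    by rewrite !mulmxA.
  by rewrite mxtrace_mulC !mulmxA.
have conjE (g Y Y' : M) : g ^t* = g ->
    \tr (Y' ^t* *m g *m Y *m g) = (\tr (Y ^t* *m g *m Y' *m g))^*%R.
  move=> gh; rewrite -trace_map_mx -[RHS]mxtrace_tr map_trmx.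
  have -> : (Y ^t* *m g *m Y' *m g) ^t* = g *m (Y' ^t* *m g *m Y).
    by rewrite !adjmx_mul trmxCK gh !mulmxA.
  by rewrite [RHS]mxtrace_mulC.
have sqE (a a' b b' g h : M) : g ^t* = g -> h ^t* = h ->
    \tr ((a *m h *m a' ^t*) ^t* *m g *m (b *m h *m b' ^t*) *m g) *
    \tr ((b *m h *m b' ^t*) ^t* *m g *m (a *m h *m a' ^t*) *m g) =
    \tr (h *m (a ^t* *m g *m b) *m h *m (a' ^t* *m g *m b') ^t*) *
    (\tr (h *m (a ^t* *m g *m b) *m h *m (a' ^t* *m g *m b') ^t*))^*%R.
  move=> gg hh; rewrite -(cyc a a' b b' g h gg hh).
  by rewrite -(conjE g (a *m h *m a' ^t*) (b *m h *m b' ^t*) gg).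
move=> P; rewrite mxtrace_hpow2 mps_realign_gram mxtrace_mxof_sqr tens_inner.
rewrite -(pair_bigA _ (fun b1 b1' => \sum_b2 \tr ((X (b1, b1')) ^t* *m G *m X b2 *m G) *
  \tr ((X b2) ^t* *m G *m X (b1, b1') *m G))) /=.
rewrite -(pair_bigA _ (fun b1 b2 => \sum_b' \tr (Gam *m P (b1, b2) *m Gam *m (P b') ^t*) *
  (\tr (Gam *m P (b1, b2) *m Gam *m (P b') ^t*))^*%R)) /=.
apply: eq_bigr => b1 _.
transitivity (\sum_b1' \sum_b2 \sum_b2' \tr (Gam *m P (b1, b2) *m Gam *m (P (b1', b2')) ^t*) *
  (\tr (Gam *m P (b1, b2) *m Gam *m (P (b1', b2')) ^t*))^*%R).
  apply: eq_bigr => b1' _; rewrite pair_bigA /=; apply: eq_bigr => -[b2 b2'] _.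
  exact: (sqE _ _ _ _ _ _ Gh Gamh).
rewrite exchange_big /=; apply: eq_bigr => b2 _.
by rewrite pair_bigA; apply: eq_bigr => -[].
Qed.

End Mps.
End Realign.

(** * Semantics and cost of loop nests *)

Fixpoint fors (x : nat) (es : seq nexp) (c : cmd) : cmd :=
  if es is e :: es' then For x e (fors x.+1 es' c) else c.

(* Einstein summation; its loop counters are the variables from 10 on, first those of
   the entries [xs], then the summed ones [ys]. *)
Definition einsum (a : nat) (tx xs ys : seq nexp) (body : sexp) : cmd :=
  fors 10 xs (Seqc (Assign a tx (SCst 0))
    (fors (10 + size xs) ys (Assign a tx (SAdd (SGet a tx) body)))).

Definition env (v : nenv) (l : seq nat) : nenv :=
  fun y => (if (10 <= y) && (y - 10 < size l) then nth 0 l (y - 10) else v y)%N.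

(** Variables below 10 are the size parameters and the site counter. Expressions in these alone keep
    their value inside a nest, so loop bounds and costs do not vary with the iteration. *)
Fixpoint nclosed (e : nexp) : bool :=
  match e with
  | NVar x => x < 10
  | NCst _ => true
  | NAdd e1 e2 | NSub e1 e2 | NMul e1 e2 => nclosed e1 && nclosed e2
  end%N.

Fixpoint reads (a : nat) (e : sexp) : bool :=
  match e with
  | SGet b _ => b == a
  | SCst _ => false
  | SAdd e1 e2 | SSub e1 e2 | SMul e1 e2 | SDiv e1 e2 | SPow e1 e2 =>
      reads a e1 || reads a e2
  | SConj e1 | SLn e1 => reads a e1
  end.

Fixpoint inrange (ds l : seq nat) : bool :=
  match ds, l with
  | [::], [::] => true
  | d :: ds', k :: l' => (k < d)%N && inrange ds' l'
  | _, _ => false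
  end.

Section Semantics.
Variables (R : realType) (S : dense_solver R).
Local Notation C := R[i].

Fixpoint msum (ds : seq nat) (f : seq nat -> C) : C :=
  if ds is d :: ds' then \sum_(k < d) msum ds' (fun l => f (val k :: l)) else f [::].

Lemma env_nil v : env v [::] = v.
Proof. by apply/funext => y; rewrite /env ltn0 andbF. Qed.

Lemma bind_env v l k : bind (env v l) (10 + size l) k = env v (rcons l k).
Proof.
apply/funext => y; rewrite /bind /env size_rcons nth_rcons.
case: eqP => [->|/eqP ne]; first by rewrite leq_addr addKn ltnSn ltnn eqxx.
have [y10|//] /= := leqP 10%N y.
have -> : (y - 10 < (size l).+1)%N = (y - 10 < size l)%N by lia.
by case: ltnP.
Qed.

Lemma neval_env v l e : nclosed e -> neval (env v l) e = neval v e.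
Proof.
elim: e => //= [x x10|e1 IH1 e2 IH2|e1 IH1 e2 IH2|e1 IH1 e2 IH2].
- by rewrite /env leqNgt x10.
all: by case/andP => /IH1 -> /IH2 ->.
Qed.

Lemma seval_frame a v (m m' : Defs.mem R) e : ~~ reads a e ->
  (forall b ix, b != a -> m' b ix = m b ix) -> seval v m' e = seval v m e.
Proof.
move=> ra H; elim: e ra => //=.
- by move=> b ix ba; rewrite H.
1-4,6: by move=> e1 IH1 e2 IH2; rewrite negb_or => /andP[/IH1 -> /IH2 ->].
all: by move=> e1 IH1 /IH1 ->.
Qed.

Lemma eq_msum ds f g : (forall l, inrange ds l -> f l = g l) -> msum ds f = msum ds g.
Proof.
elim: ds f g => [|d ds IH] f g fg /=; first exact: fg.
by apply: eq_bigr => k _; apply: IH => l lr; apply: fg; rewrite /= ltn_ord.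
Qed.

Lemma putE (m : Defs.mem R) a ix z b jx :
  put m a ix z b jx = if (b == a) && (jx == ix) then z else m b jx.
Proof. by []. Qed.

(** All iterations accumulate into the single cell [ix]; as [body] does not read the array [a],
    every increment can be evaluated in the initial memory. *)
Lemma exec_sum_nest v a tx ys body l (m : Defs.mem R) ix :
    all nclosed ys -> ~~ reads a body ->
    (forall l', map (neval (env v (l ++ l'))) tx = ix) ->
  exec S (fors (10 + size l) ys (Assign a tx (SAdd (SGet a tx) body))) (env v l) m
  = put m a ix (m a ix + msum (map (neval v) ys)
      (fun l' => seval (env v (l ++ l')) m body)).
Proof.
elim: ys l m => [|y ys IH] l m /= cl ra txE.
  by have := txE [::]; rewrite cats0 => ->.
case/andP: cl => cy cys.
rewrite neval_env //; set d := neval v y.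
have H k (m' : Defs.mem R) : exec S (fors (10 + size l).+1 ys (Assign a tx (SAdd (SGet a tx) body)))
    (bind (env v l) (10 + size l) k) m' = put m' a ix (m' a ix + msum (map (neval v) ys)
      (fun l' => seval (env v (l ++ k :: l')) m' body)).
  rewrite bind_env -addnS -(size_rcons l k) IH //; last first.
    by move=> l'; rewrite cat_rcons.
  congr (put _ _ _ (_ + _)); apply: eq_msum => l' _.
  by rewrite cat_rcons.
pose P t := \sum_(k < t) msum (map (neval v) ys)
      (fun l' => seval (env v (l ++ val k :: l')) m body).
suff -> : forall t, foldl (fun m' k => exec S (fors (10 + size l).+1 ys
    (Assign a tx (SAdd (SGet a tx) body))) (bind (env v l) (10 + size l) k) m') m (iota 0 t)
    = put m a ix (m a ix + P t) by [].
elim=> [|t IHt].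
  rewrite /P big_ord0 addr0; apply/funext => b; apply/funext => jx.
  by rewrite putE; case: andP => // -[/eqP -> /eqP ->].
rewrite -[t.+1]addn1 iotaD foldl_cat IHt /= H add0n; apply/funext => b; apply/funext => jx.
rewrite !putE !eqxx /=; case: ifP => [_|->] //.
rewrite /P addn1 big_ord_recr /= addrA; congr (_ + _); apply: eq_msum => l' _.
by apply: (seval_frame _ ra) => b' jx'; rewrite putE => /negPf ->.
Qed.

(** [g] decodes an address into the counters that write there. Its existence makes addresses
    injective, so that no entry is overwritten, also for computed addresses such as fused
    indices. *)
Definition target_inverse v tx (ds : seq nat) (g : seq nat -> option (seq nat)) :=
  forall ix l, g ix = Some l <-> inrange ds l /\ map (neval (env v l)) tx = ix.

(** Values depend only on arrays other than [a], and addresses are pairwise distinct, so earlier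
    iterations influence no later one and their results survive. *)
Lemma exec_fors_put v a tx xs c l (val : seq nat -> Defs.mem R -> C) (m : Defs.mem R) :
    all nclosed xs ->
    (forall l m m', (forall b ix, b != a -> m' b ix = m b ix) -> val l m' = val l m) ->
    (forall l' m, inrange (map (neval v) xs) l' -> exec S c (env v (l ++ l')) m =
       put m a (map (neval (env v (l ++ l'))) tx) (val (l ++ l') m)) ->
    (forall l1 l2, inrange (map (neval v) xs) l1 -> inrange (map (neval v) xs) l2 ->
       map (neval (env v (l ++ l1))) tx = map (neval (env v (l ++ l2))) tx -> l1 = l2) ->
  let m' := exec S (fors (10 + size l) xs c) (env v l) m in
  [/\ forall b ix, b != a -> m' b ix = m b ix,
      forall l', inrange (map (neval v) xs) l' ->
        m' a (map (neval (env v (l ++ l'))) tx) = val (l ++ l') m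
    & forall ix, (forall l', inrange (map (neval v) xs) l' ->
        map (neval (env v (l ++ l'))) tx <> ix) -> m' a ix = m a ix].
Proof.
move=> + valE; elim: xs l m => [|x xs IH] l m /= cl cE inj.
  have := cE [::] m isT; rewrite cats0 => E; rewrite E; split.
  - by move=> b ix ba; rewrite putE (negPf ba).
  - by case=> // _; rewrite cats0 putE !eqxx.
  - by move=> ix /(_ [::] isT); rewrite cats0 putE eqxx /= => /eqP/negPf; rewrite eq_sym => ->.
case/andP: cl => cx cxs; rewrite neval_env //; set d := neval v x in inj cE *.
pose m1 t := foldl (fun m' k => exec S (fors (10 + size l).+1 xs c)
   (bind (env v l) (10 + size l) k) m') m (iota 0 t).
suff H t : (t <= d)%N -> [/\ forall b ix, b != a -> m1 t b ix = m b ix,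
    forall k l', (k < t)%N -> inrange (map (neval v) xs) l' ->
        m1 t a (map (neval (env v (l ++ k :: l'))) tx) = val (l ++ k :: l') m
  & forall ix, (forall k l', (k < t)%N -> inrange (map (neval v) xs) l' ->
        map (neval (env v (l ++ k :: l'))) tx <> ix) -> m1 t a ix = m a ix].
  have [H1 H2 H3] := H d (leqnn d); split=> //.
    by case=> // k l' /andP[kd lr]; apply: H2.
  by move=> ix Hix; apply: H3 => k l' kd lr; apply: Hix; rewrite kd.
elim: t => [|t IHt] td; first by split.
have [H1 H2 H3] := IHt (ltnW td).
have E : m1 t.+1 = exec S (fors (10 + size (rcons l t)) xs c) (env v (rcons l t)) (m1 t).
  by rewrite /m1 -[t.+1]addn1 iotaD foldl_cat /= add0n bind_env size_rcons addnS.
have [||I1 I2 I3] := IH (rcons l t) (m1 t) cxs.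
- by move=> l' m' lr; rewrite cat_rcons cE //= td.
- move=> l1 l2 r1 r2; rewrite !cat_rcons => e.
  by have := inj (t :: l1) (t :: l2); rewrite /= td => /(_ r1 r2 e) [].
rewrite -E in I1 I2 I3; split.
- by move=> b ix ba; rewrite I1 // H1.
- move=> k l'; rewrite ltnS leq_eqVlt => /predU1P[->|kt] lr.
    by rewrite -cat_rcons I2 // (valE _ m).
  rewrite I3 ?H2 // => l2 lr2; rewrite cat_rcons => e.
  have := inj (t :: l2) (k :: l'); rewrite /= td (ltn_trans kt td) => /(_ lr2 lr e) [tk _].
  by rewrite tk ltnn in kt.
move=> ix Hix; rewrite I3 ?H3 // => [k l' kt lr|l' lr].
  by apply: Hix; rewrite // ltnS ltnW.
by rewrite cat_rcons; apply: Hix.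
Qed.

Lemma exec_einsum v a tx xs ys body g (m : Defs.mem R) :
    all nclosed xs -> all nclosed ys -> ~~ reads a body ->
    (forall l l', size l = size xs ->
       map (neval (env v (l ++ l'))) tx = map (neval (env v l)) tx) ->
    target_inverse v tx (map (neval v) xs) g ->
  exec S (einsum a tx xs ys body) v m = fun b ix =>
    if b == a then if g ix is Some l
      then msum (map (neval v) ys) (fun l' => seval (env v (l ++ l')) m body)
      else m b ix else m b ix.
Proof.
move=> cx cy ra txE gE.
have szr ds l : inrange ds l -> size l = size ds.
  by elim: ds l => [|d ds IH] [|k l] //= /andP[_ /IH ->].
pose val l m := msum (map (neval v) ys) (fun l' => seval (env v (l ++ l')) m body).
have := @exec_fors_put v a tx xs (Seqc (Assign a tx (SCst 0))
    (fors (10 + size xs) ys (Assign a tx (SAdd (SGet a tx) body)))) [::] val m cx.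
rewrite env_nil => -[|||H1 H2 H3].
- move=> l m1 m2 mE; apply: eq_msum => l' _; exact: seval_frame ra mE.
- move=> l m1 lr /=; have sl := szr _ _ lr; rewrite size_map in sl.
  rewrite -sl (@exec_sum_nest _ _ _ _ _ _ _ (map (neval (env v l)) tx)) //; last first.
    by move=> l'; apply: txE.
  apply/funext => b; apply/funext => jx; rewrite !putE !eqxx /=.
  case: ifP => [_|->] //; rewrite add0r; apply: eq_msum => l' _.
  by apply: (seval_frame _ ra) => b' jx'; rewrite putE => /negPf ->.
- move=> l1 l2 r1 r2 e; have := (gE (map (neval (env v l1)) tx) l1).2 (conj r1 erefl).
  by rewrite ((gE _ l2).2 (conj r2 (esym e))) => -[].
apply/funext => b; apply/funext => ix; case: eqP => [->|/eqP ba]; last exact: H1.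
case gix: (g ix) => [l|].
  by have [lr <-] := (gE _ _).1 gix; apply: H2.
by apply: H3 => l lr e; have := (gE ix l).2 (conj lr e); rewrite gix.
Qed.

Lemma nth_env_iota v l l' : map (neval (env v (l ++ l'))) (map NVar (iota 10 (size l))) = l.
Proof.
apply: (@eq_from_nth _ 0%N); rewrite !size_map size_iota // => i il.
rewrite (nth_map (NCst 0)) ?size_map ?size_iota // (nth_map 0%N) ?size_iota //=.
by rewrite nth_iota // /env leq_addr addKn size_cat ltn_addr // nth_cat il.
Qed.

Lemma env_iota v l : map (neval (env v l)) (map NVar (iota 10 (size l))) = l.
Proof. by have := nth_env_iota v l [::]; rewrite cats0. Qed.

Definition tensor (a : nat) (xs ys : seq nexp) (body : sexp) : cmd :=
  einsum a (map NVar (iota 10 (size xs))) xs ys body.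

Lemma exec_tensor v a xs ys body (m : Defs.mem R) :
    all nclosed xs -> all nclosed ys -> ~~ reads a body ->
  exec S (tensor a xs ys body) v m = fun b ix =>
    if (b == a) && inrange (map (neval v) xs) ix
      then msum (map (neval v) ys) (fun l' => seval (env v (ix ++ l')) m body)
      else m b ix.
Proof.
move=> cx cy ra; rewrite /tensor.
rewrite (@exec_einsum _ _ _ _ _ _ (fun ix => if inrange (map (neval v) xs) ix then Some ix else None)) //.
- apply/funext => b; apply/funext => ix; case: eqP => [->|//] /=.
  by case: ifP.
- by move=> l l' <-; rewrite nth_env_iota env_iota.
have szr ds l : inrange ds l -> size l = size ds.
  by elim: ds l => [|d ds IH] [|k l] //= /andP[_ /IH ->].
move=> ix l; split.
  case: ifP => // r [<-]; split=> //; have := szr _ _ r; rewrite size_map => <-.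
  by rewrite env_iota.
move=> [r]; have := szr _ _ r; rewrite size_map => <-.
by rewrite env_iota => <-; rewrite r.
Qed.

End Semantics.

(** * Operation counts of loop nests *)

Definition prodn (s : seq nat) : nat := foldr muln 1%N s.

Lemma eq_neval v v' e : nclosed e ->
  (forall x, (x < 10)%N -> v' x = v x) -> neval v' e = neval v e.
Proof.
move=> + vv; elim: e => //= e1 IH1 e2 IH2.
all: by case/andP => /IH1 -> /IH2 ->.
Qed.

Lemma cost_fors x es c v c0 : all nclosed es -> (10 <= x)%N ->
    (forall v', (forall x, (x < 10)%N -> v' x = v x) -> cost c v' = c0) ->
  cost (fors x es c) v = (prodn (map (neval v) es) * c0)%N.
Proof.
move=> + + cE; elim: es x v cE => [|e es IH] x v /= cE; first by rewrite mul1n cE.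
case/andP=> ce ces x10.
have bE k y : (y < 10)%N -> bind v x k y = v y.
  by move=> y10; rewrite /bind ltn_eqF // (leq_trans y10).
have E k : cost (fors x.+1 es c) (bind v x k) = (prodn (map (neval v) es) * c0)%N.
  rewrite IH ?(leqW x10) //; last first.
    by move=> v' v'E; apply: cE => y y10; rewrite v'E // bE.
  congr (prodn _ * _)%N; elim: es ces {IH} => //= y ys IHys /andP[cy /IHys ->].
  by rewrite (eq_neval cy (bE k)).
by under eq_bigr do rewrite E; rewrite sum_nat_const card_ord mulnA.
Qed.

(** Each term costs one addition and one assignment besides the body, which is the [.+2]; the outer
    [.+1] is the reset of the cell. *)
Lemma cost_einsum a tx xs ys body v :
    all nclosed xs -> all nclosed ys ->
  cost (einsum a tx xs ys body) v =
  (prodn (map (neval v) xs) *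
     (prodn (map (neval v) ys) * (sops body).+2).+1)%N.
Proof.
move=> cx cy; apply: cost_fors => // v' v'E /=.
rewrite (cost_fors (c0 := (sops body).+2)) //.
rewrite add1n; congr (prodn _ * _).+1.
by elim: ys cy => //= y ys IH /andP[cy /IH ->]; rewrite (eq_neval cy v'E).
Qed.

(** * Transfer steps as programs *)

Fixpoint writes (c : cmd) : seq nat :=
  match c with
  | Skip => [::]
  | Assign a _ _ => [:: a]
  | Seqc c1 c2 => writes c1 ++ writes c2
  | For _ _ c1 => writes c1
  | Eigh _ _ u l => [:: u; l]
  | Svd _ _ u l w => [:: u; l; w]
  end.

Lemma writes_Seqc c1 c2 : writes (Seqc c1 c2) = writes c1 ++ writes c2.
Proof. by []. Qed.

Lemma writes_tensor a xs ys body : writes (tensor a xs ys body) = [:: a; a].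
Proof.
have wf x es c : writes (fors x es c) = writes c by elim: es x => //= e es IH x.
by rewrite /tensor /einsum wf /= wf.
Qed.

Arguments tensor : simpl never.
Arguments einsum : simpl never.
Arguments env : simpl never.

Section Programs.
Variables (R : realType) (S : dense_solver R).
Local Notation C := R[i].

Lemma exec_frame c v (m : Defs.mem R) b : b \notin writes c -> exec S c v m b = m b.
Proof.
elim: c v m => //=.
- by move=> a ix e v m; rewrite inE => /negPf ba; apply/funext => jx; rewrite putE ba.
- move=> c1 IH1 c2 IH2 v m; rewrite mem_cat negb_or => /andP[b1 b2].
  by rewrite IH2 // IH1.
- move=> x e c IH v m bc; elim: (iota _ _) m => //= k ks IHk m.
  by rewrite IHk IH.
- move=> e a u l v m; rewrite !inE negb_or => /andP[/negPf bu /negPf bl].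
  by apply/funext => jx; rewrite /store_rv /store_mx bl bu.
- move=> e a u l w v m; rewrite !inE !negb_or => /and3P[/negPf bu /negPf bl /negPf bw].
  by apply/funext => jx; rewrite /store_mx /store_rv bl bu bw.
Qed.

Lemma exec_Seqc c1 c2 v m : exec S (Seqc c1 c2) v m = exec S c2 v (exec S c1 v m).
Proof. by []. Qed.

Lemma exec_For_ind (P : nat -> Defs.mem R -> Prop) x e c v m :
    P 0 m ->
    (forall k m', (k < neval v e)%N -> P k m' -> P k.+1 (exec S c (bind v x k) m')) ->
  P (neval v e) (exec S (For x e c) v m).
Proof.
move=> P0 PS /=; set N := neval v e in PS *.
suff H t : (t <= N)%N -> P t (foldl (fun m' k => exec S c (bind v x k) m') m (iota 0 t)).
  exact: H.
elim: t => [|t IH] tN //; rewrite -addn1 iotaD foldl_cat /= add0n addn1.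
by apply: PS => //; apply: IH; apply: ltnW.
Qed.

Lemma env10 v x l : env v (x :: l) 10 = x. Proof. by []. Qed.
Lemma env11 v x y l : env v (x :: y :: l) 11 = y. Proof. by []. Qed.
Lemma env12 v x y z l : env v [:: x, y, z & l] 12 = z. Proof. by []. Qed.
Lemma env13 v x y z w l : env v [:: x, y, z, w & l] 13 = w. Proof. by []. Qed.
Lemma env14 v x y z w s l : env v [:: x, y, z, w, s & l] 14 = s. Proof. by []. Qed.
Lemma env15 v x y z w s t l : env v [:: x, y, z, w, s, t & l] 15 = t. Proof. by []. Qed.
Definition envE := (env10, env11, env12, env13, env14, env15).

(** One step of [sweep]. The intermediate array [t] keeps the physical index, so that each
    contraction sums one bond index and costs chi^3 instead of chi^4. *)
Definition conj_step (a t : nat) (d chi : nexp) (A : nexp -> nexp -> nexp -> sexp) : cmd :=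
  Seqc
    (tensor t [:: d; chi; chi] [:: chi]
      (SMul (A (NVar 10) (NVar 11) (NVar 13)) (SGet a [:: NVar 13; NVar 12])))
    (tensor a [:: chi; chi] [:: d; chi]
      (SMul (SGet t [:: NVar 12; NVar 10; NVar 13])
            (SConj (A (NVar 12) (NVar 11) (NVar 13))))).

(** The two legs are multiplied one after the other, at chi^5 each, and the shared physical index is
    summed at the end. The result is stored with the untouched legs in front: the next such step
    acts on those, which amounts to multiplication from the right. *)
Definition pair_step (a t b : nat) (d chi : nexp) (A : nexp -> nexp -> nexp -> sexp) : cmd :=
  Seqc
    (tensor t [:: d; chi; chi; chi; chi] [:: chi]
      (SMul (A (NVar 10) (NVar 11) (NVar 15)) (SGet a [:: NVar 15; NVar 12; NVar 13; NVar 14])))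
    (tensor b [:: chi; chi; chi; chi] [:: d; chi]
      (SMul (SGet t [:: NVar 14; NVar 12; NVar 15; NVar 10; NVar 11])
            (SConj (A (NVar 14) (NVar 13) (NVar 15))))).

(* The site counter is variable 9. *)
Definition run_sweep (a t : nat) (len : nexp) (d z : nat)
    (A : nexp -> nexp -> nexp -> sexp) : cmd :=
  Seqc (Assign a [:: NCst 0; NCst 0] (SCst 1))
    (For 9 len (conj_step a t (NCst d) (NVar z) A)).

Definition shalf : sexp := SDiv (SCst 1) (SCst 2).

Definition factor_cmd (z : nat) : cmd :=
  Seqc (Eigh (NVar z) 10 20 21)
    (tensor 14 [:: NVar z; NVar z] [::]
      (SMul (SPow (SGet 21 [:: NVar 10]) shalf)
            (SConj (SGet 20 [:: NVar 11; NVar 10])))).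

Definition spectrum_cmd (D : nexp) (a : nat) (e : sexp) : cmd :=
  Seqc (Eigh D a 22 23)
    (tensor 0 [::] [:: D] (SPow (SGet 23 [:: NVar 10]) e)).

Variable c : nat.
Local Notation M := 'M[C]_c.+1.

(* [A] is program text for the entries of the matrices [Am s]; [enc] numbers the values
   [s] of a physical index, and [ws] are the arrays written meanwhile. *)
Definition denotes (I : finType) (enc : I -> nat) (v : nenv) (m : Defs.mem R) (ws : seq nat)
    (A : nexp -> nexp -> nexp -> sexp) (Am : I -> M) :=
  (forall b e1 e2 e3, b \in ws -> ~~ reads b (A e1 e2 e3)) /\
  (forall l m' e1 e2 e3 s (x y : 'I_c.+1),
     (forall b, b \notin ws -> m' b = m b) ->
     neval (env v l) e1 = enc s -> neval (env v l) e2 = x -> neval (env v l) e3 = y ->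
     seval (env v l) m' (A e1 e2 e3) = Am s x y).

(** Bijectivity of [enc] onto the numbers below [d], in the form in which it is used: transport of
    loop sums. *)
Definition numbers (I : finType) (enc : I -> nat) (d : nat) :=
  exists encd : forall s, (enc s < d)%N,
    forall f : 'I_d -> C, \sum_k f k = \sum_s f (Ordinal (encd s)).

Lemma load_conj_step (I : finType) (enc : I -> nat) a t d chi A Am v m :
    a != t -> nclosed d -> nclosed chi -> neval v chi = c.+1 ->
    numbers enc (neval v d) -> denotes enc v m [:: a; t] A Am ->
  load_mx c.+1 (exec S (conj_step a t d chi A) v m) a =
  \sum_s Am s *m load_mx c.+1 m a *m (Am s) ^t*.
Proof.
move=> /negPf at_ cd cchi chiE [encd sumE] [Ar AE]; apply/matrixP => k l.
have ta : (t == a) = false by rewrite eq_sym.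
rewrite [LHS]mxE exec_Seqc !exec_tensor; try by rewrite /= ?cd ?cchi ?negb_or ?Ar ?inE ?ta ?at_ ?eqxx ?orbT.
rewrite /= chiE !ltn_ord eqxx /= sumE summxE; apply: eq_bigr => s _.
rewrite mxE; apply: eq_bigr => l' _ /=.
rewrite !envE eqxx encd !ltn_ord /=; congr (_ * _).
  rewrite mxE; apply: eq_bigr => k' _ /=; rewrite !envE.
  by rewrite (AE _ _ _ _ _ s k k') //= !mxE.
rewrite (AE _ _ _ _ _ s l l') ?mxE // => b.
by rewrite !inE negb_or => /andP[_ /negPf bt]; apply/funext => ix; rewrite bt.
Qed.

Lemma pair_step_tens (I J : finType) (enc : I -> nat) a t b d chi A Am (P : J -> M) v m :
    a != t -> b != t -> nclosed d -> nclosed chi -> neval v chi = c.+1 ->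
    numbers enc (neval v d) -> denotes enc v m [:: t; b] A Am ->
    (forall x y z w : 'I_c.+1, m a [:: val x; val y; val z; val w] = tens P x y z w) ->
  forall x y z w : 'I_c.+1,
  exec S (pair_step a t b d chi A) v m b [:: val z; val w; val x; val y] =
  tens (fun sj : I * J => Am sj.1 *m P sj.2) x y z w.
Proof.
move=> /negPf at_ /negPf bt cd cchi chiE [encd sumE] [Ar AE] aE x y z w.
have tb : (t == b) = false by rewrite eq_sym.
rewrite exec_Seqc !exec_tensor; try by rewrite /= ?cd ?cchi ?negb_or ?Ar ?inE ?tb ?at_ ?eqxx ?orbT.
rewrite /= chiE !ltn_ord eqxx /= sumE /tens -(pair_bigA _ (fun s j =>
  (Am s *m P j) x z * ((Am s *m P j) y w)^*%R)); apply: eq_bigr => s _ /=.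
under eq_bigr => y' _.
  rewrite /= !envE eqxx encd !ltn_ord /= (AE _ _ _ _ _ s y y') //; last first.
    move=> b'; rewrite !inE negb_or => /andP[/negPf bt' _].
    by apply/funext => ix; rewrite bt'.
  rewrite mulr_suml.
  under eq_bigr => x' _.
    rewrite !envE (AE _ _ _ _ _ s x x') // aE /tens mulr_sumr mulr_suml; over.
  over.
under eq_bigr do rewrite exchange_big /=.
rewrite exchange_big /=; apply: eq_bigr => j _.
rewrite !mxE rmorph_sum mulr_sumr; apply: eq_bigr => y' _.
rewrite mulr_suml; apply: eq_bigr => x' _.
by rewrite rmorphM /=; ring.
Qed.


Definition holds (I : finType) (enc : I -> nat) (m : Defs.mem R) at_ (T : nat -> I -> M) n :=
  forall i s (l r : 'I_c.+1), (i < n)%N -> m at_ [:: i; enc s; val l; val r] = T i s l r.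

Section Denotes.
Variables (I : finType) (enc : I -> nat) (v : nenv) (m : Defs.mem R) (ws : seq nat).
Variables (a n : nat) (T : nat -> I -> M).
Hypotheses (aws : a \notin ws) (mT : holds enc m a T n).

Let read_notin b : b \in ws -> (a == b) = false.
Proof. by apply: contraTF => /eqP <-. Qed.

Lemma denotes_site e : nclosed e -> (neval v e < n)%N ->
  denotes enc v m ws (fun s x y => SGet a [:: e; s; x; y]) (T (neval v e)).
Proof.
move=> ce en; split=> [b e1 e2 e3 /read_notin /= -> //|l m' e1 e2 e3 s x y m'E /= -> -> ->].
by rewrite m'E // neval_env // mT.
Qed.

Lemma denotes_site_tr e : nclosed e -> (neval v e < n)%N ->
  denotes enc v m ws (fun s x y => SGet a [:: e; s; y; x]) (fun s => (T (neval v e) s)^T).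
Proof.
move=> ce en; split=> [b e1 e2 e3 /read_notin /= -> //|l m' e1 e2 e3 s x y m'E /= -> -> ->].
by rewrite m'E // neval_env // mT // mxE.
Qed.

Lemma denotes_site_adj e : nclosed e -> (neval v e < n)%N ->
  denotes enc v m ws (fun s x y => SConj (SGet a [:: e; s; y; x]))
    (fun s => (T (neval v e) s) ^t*).
Proof.
move=> ce en; split=> [b e1 e2 e3 /read_notin /= -> //|l m' e1 e2 e3 s x y m'E /= -> -> ->].
by rewrite m'E // neval_env // mT // !mxE.
Qed.

Lemma denotes_mx (en : unit -> nat) (X : M) : load_mx c.+1 m a = X ->
  denotes en v m ws (fun s x y => SGet a [:: x; y]) (fun=> X).
Proof.
move=> <-; split=> [b e1 e2 e3 /read_notin /= -> //|l m' e1 e2 e3 s x y m'E /= _ -> ->].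
by rewrite m'E // mxE.
Qed.

Lemma denotes_mx_tr (en : unit -> nat) (X : M) : load_mx c.+1 m a = X ->
  denotes en v m ws (fun s x y => SGet a [:: y; x]) (fun=> X^T).
Proof.
move=> <-; split=> [b e1 e2 e3 /read_notin /= -> //|l m' e1 e2 e3 s x y m'E /= _ -> ->].
by rewrite m'E // !mxE.
Qed.

End Denotes.

Lemma exec_conj_step_frame a t d chi A v m b :
  b != a -> b != t -> exec S (conj_step a t d chi A) v m b = m b.
Proof.
move=> /negPf ba /negPf bt; apply: exec_frame.
by rewrite writes_Seqc !writes_tensor !inE ba bt.
Qed.

Lemma load_run_sweep (I : finType) (enc : I -> nat) a t at_ len d z A
    (Am : nat -> I -> M) v m :
    a != t -> at_ != a -> at_ != t -> (z < 9)%N -> v z = c.+1 ->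
    (forall ix, m a ix = 0) -> numbers enc d ->
    (forall k m', (k < neval v len)%N -> m' at_ = m at_ ->
       denotes enc (bind v 9 k) m' [:: a; t] A (Am k)) ->
  load_mx c.+1 (exec S (run_sweep a t len d z A) v m) a =
  sweep Am (delta_mx 0 0) (neval v len).
Proof.
move=> at' ata att z9 vz ma0 numd AE.
pose P k m' := load_mx c.+1 m' a = sweep Am (delta_mx 0 0) k /\ m' at_ = m at_.
suff [] : P (neval v len) (exec S (run_sweep a t len d z A) v m) by [].
rewrite /run_sweep exec_Seqc; apply: exec_For_ind.
  split; last by apply: exec_frame; rewrite inE.
  (* Setting one cell creates the initial projector because the array was blank. *)
  apply/matrixP => i j; rewrite !mxE /= putE eqxx /= ma0 !eqseq_cons andbT -!val_eqE /=.
  by case: andP.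
move=> k m' kn [m'G m'at]; split; last by rewrite exec_conj_step_frame.
have numd' : numbers enc (neval (bind v 9 k) (NCst d)) by [].
rewrite (load_conj_step at' _ _ _ numd' (AE k m' kn m'at)) ?m'G //.
  exact: leqW.
by rewrite /= /bind ltn_eqF.
Qed.

(** A dummy physical index with one value: multiplication by [Gam] becomes an instance of the site
    step. *)
Lemma numbers_unit : numbers (fun _ : unit => 0%N) 1.
Proof.
by exists (fun=> isT) => f; rewrite big_ord1 (big_pred1 tt) => [|[]]; [congr f; apply: val_inj|].
Qed.

Lemma numbers_bool : numbers (fun b : bool => nat_of_bool b) 2.
Proof.
have lt (b : bool) : (b < 2)%N by case: b.
exists lt => f; rewrite big_bool !big_ord_recl big_ord0 addr0 addrC.
by congr (f _ + f _); apply: val_inj.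
Qed.

Lemma numbers_pair : numbers (fun s : bool * bool => (2 * s.1 + s.2)%N) 4.
Proof.
have lt (s : bool * bool) : (2 * s.1 + s.2 < 4)%N by case: s => [[] []].
exists lt => f; transitivity (\sum_a \sum_b f (Ordinal (lt (a, b)))); last first.
  by rewrite pair_bigA; apply: eq_bigr => -[].
rewrite !big_bool /= !big_ord_recl big_ord0 addr0.
have perm4 (x y z w : C) : x + (y + (z + w)) = w + z + (y + x) by ring.
by rewrite perm4; congr (f _ + f _ + (f _ + f _)); apply: val_inj.
Qed.

Lemma store_rv_ord n (m' : Defs.mem R) a (d : 'rV[R]_n) i :
  store_rv m' a d a [:: nat_of_ord i] = (d 0 i)%:C.
Proof. by rewrite /store_rv eqxx /= -[0%N]/(val (0 : 'I_1)) entry_ord mxE. Qed.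

Lemma store_mx_ord n (m' : Defs.mem R) a (X : 'M[C]_n) i j :
  store_mx m' a X a [:: nat_of_ord i; nat_of_ord j] = X i j.
Proof. by rewrite /store_mx eqxx /= entry_ord. Qed.

Lemma Re_half v (m : Defs.mem R) : complex.Re (seval v m shalf) = 2^-1.
Proof. by rewrite /=; field. Qed.

Lemma seval_SMul v (m : Defs.mem R) e1 e2 :
  seval v m (SMul e1 e2) = seval v m e1 * seval v m e2.
Proof. by []. Qed.

Lemma seval_SPow v (m : Defs.mem R) e1 e2 :
  seval v m (SPow e1 e2) =
  (complex.Re (seval v m e1) `^ complex.Re (seval v m e2))%:C.
Proof. by []. Qed.

Lemma msum_nil (f : seq nat -> C) : msum [::] f = f [::].
Proof. by []. Qed.

Lemma load_factor z v m (G : M) :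
    (z < 9)%N -> v z = c.+1 -> load_mx c.+1 m 10 = G ->
  load_mx c.+1 (exec S (factor_cmd z) v m) 14 =
  \matrix_(i, j) (((eigh S G).2 0 i `^ 2^-1)%:C * ((eigh S G).1 j i)^*%R).
Proof.
move=> z9 vz mG; apply/matrixP => i j; rewrite mxE [RHS]mxE /factor_cmd exec_Seqc.
rewrite exec_tensor ?andbT //; last by rewrite /= leqW.
rewrite (_ : _ && _ = true); last by rewrite /= vz !ltn_ord.
rewrite msum_nil cats0 seval_SMul seval_SPow Re_half /= vz mG !envE; congr (_%:C * _).
  by rewrite store_rv_ord.
by rewrite -[store_rv _ _ _ _ _]/(store_mx _ _ _ _ _) store_mx_ord.
Qed.

Lemma spectrum_output D a e v m n (K : 'M[C]_n) (x : R) :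
    nclosed D -> neval v D = n -> load_mx n m a = K -> ~~ reads 0 e ->
    (forall l m', (forall b, b != 22 -> b != 23 -> b != 0 -> m' b = m b)%N ->
        complex.Re (seval (env v l) m' e) = x) ->
  exec S (spectrum_cmd D a e) v m 0 [::] = \sum_i (((eigh S K).2 0 i) `^ x)%:C.
Proof.
move=> cD vD mK e0 ex; rewrite exec_Seqc exec_tensor //=; last by rewrite cD.
rewrite vD mK; apply: eq_bigr => i _; rewrite /= envE ex; last first.
  by move=> b /negPf b22 /negPf b23 _; apply/funext => ix; rewrite /store_rv /store_mx b22 b23.
by rewrite store_rv_ord.
Qed.

End Programs.

(** * Matrix product operators *)

(* Array 5: the site tensors with the two physical indices fused into [2 s + t]. *)
Definition load_mpo : cmd :=
  einsum 5 [:: NVar 10; NAdd (NMul (NCst 2) (NVar 11)) (NVar 12); NVar 13; NVar 14]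
    [:: NAdd (NVar 0) (NVar 1); NCst 2; NCst 2; NVar 2; NVar 2] [::]
    (SGet 1 [:: NVar 10; NVar 11; NVar 12; NVar 13; NVar 14]).

(* Arrays 10 and 12 hold the Gram matrices of the left and the right block, 14 a factor
   [F] of the former, 16 the matrix with the nonzero spectrum of [R^* R]. *)
Definition mpo_prog (e : sexp) : cmd :=
  Seqc load_mpo
  (Seqc (run_sweep 10 11 (NVar 0) 4 2 (fun s x y => SConj (SGet 5 [:: NVar 9; s; y; x])))
  (Seqc (run_sweep 12 13 (NVar 1) 4 2 (fun s x y =>
     SGet 5 [:: NSub (NSub (NAdd (NVar 0) (NVar 1)) (NCst 1)) (NVar 9); s; x; y]))
  (Seqc (factor_cmd 2)
  (Seqc (tensor 15 [:: NVar 2; NVar 2] [:: NVar 2]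
     (SMul (SGet 14 [:: NVar 10; NVar 12]) (SGet 12 [:: NVar 12; NVar 11])))
  (Seqc (tensor 16 [:: NVar 2; NVar 2] [:: NVar 2]
     (SMul (SGet 15 [:: NVar 10; NVar 12]) (SConj (SGet 14 [:: NVar 11; NVar 12]))))
  (spectrum_cmd (NVar 2) 16 e)))))).

Section Programs.
Variables (R : realType) (S : dense_solver R).
Local Notation C := R[i].

Lemma load_tensor_mul v (m : Defs.mem R) a p q x c (X Y : 'M[C]_c.+1) :
    (x < 10)%N -> v x = c.+1 -> a != p -> a != q ->
    load_mx c.+1 m p = X -> load_mx c.+1 m q = Y ->
  load_mx c.+1 (exec S (tensor a [:: NVar x; NVar x] [:: NVar x]
     (SMul (SGet p [:: NVar 10; NVar 12]) (SGet q [:: NVar 12; NVar 11]))) v m) a = X *m Y.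
Proof.
move=> x10 vx ap aq <- <-; apply/matrixP => i j.
rewrite !mxE exec_tensor /= ?x10 // ?negb_or 1?(eq_sym p) ?ap 1?(eq_sym q) ?aq //.
rewrite vx !ltn_ord eqxx /=; apply: eq_bigr => k _.
by rewrite !envE !mxE.
Qed.

Lemma load_tensor_mul_adj v (m : Defs.mem R) a p q x c (X Y : 'M[C]_c.+1) :
    (x < 10)%N -> v x = c.+1 -> a != p -> a != q ->
    load_mx c.+1 m p = X -> load_mx c.+1 m q = Y ->
  load_mx c.+1 (exec S (tensor a [:: NVar x; NVar x] [:: NVar x]
     (SMul (SGet p [:: NVar 10; NVar 12]) (SConj (SGet q [:: NVar 11; NVar 12])))) v m) a
  = X *m Y ^t*.
Proof.
move=> x10 vx ap aq <- <-; apply/matrixP => i j.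
rewrite !mxE exec_tensor /= ?x10 // ?negb_or 1?(eq_sym p) ?ap 1?(eq_sym q) ?aq //.
rewrite vx !ltn_ord eqxx /=; apply: eq_bigr => k _.
by rewrite !envE !mxE.
Qed.

Variables (nA nB c : nat) (W : mpo R (nA + nB) c.+1).
Let v := params [:: nA; nB; c.+1].

Lemma load_mpo_holds m : m 1%N = mpo_mem W 1 ->
  holds (fun s : bool * bool => (2 * s.1 + s.2)%N) (exec S load_mpo v m) 5 (site_mx W) (nA + nB).
Proof.
move=> m1 i s l r iN.
(* Quotient and remainder by 2 recover the two bits of the fused index. *)
pose g ix := if ix is [:: i; k; l; r] then
  if inrange [:: nA + nB; 4; c.+1; c.+1]%N ix
    then Some [:: i; k %/ 2; k %% 2; l; r]%N else None else None.
rewrite /load_mpo (@exec_einsum _ _ _ _ _ _ _ _ g) //=.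
- rewrite (_ : 2 * s.1 + s.2 < 4)%N; last by case: s => [[] []].
  rewrite (_ : (2 * s.1 + s.2) %/ 2 = s.1)%N; last by case: s => [[] []].
  rewrite (_ : (2 * s.1 + s.2) %% 2 = s.2)%N; last by case: s => [[] []].
  by rewrite iN !ltn_ord /= !envE m1 mxE; case: s => [[] []].
- by case=> [|? [|? [|? [|? [|? []]]]]].
move=> ix l0; split.
  case: ix => [|i0 [|k0 [|l1 [|r0 []]]]] //=; case: ifP => // /and5P[i0l k0l l0l r0l _] [<-] /=.
  rewrite !envE i0l l0l r0l ltn_mod mulnC -divn_eq; split=> //.
  by rewrite ltn_divLR // k0l.
case: l0 => [|i0 [|s0 [|t0 [|l1 [|r0 []]]]]] /=; rewrite ?andbF; try by case.
  2: by move=> ? ? [].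
case=> /andP[i0l /andP[s0l /andP[t0l /andP[l0l /andP[r0l _]]]]] <-; rewrite !envE /= i0l l0l r0l.
rewrite (_ : 2 * s0 + t0 < 4)%N /=; last by lia.
by rewrite mulnC divnMDl // divn_small // addn0 modnMDl modn_small.
Qed.

(** The exponent is an expression [e] of value [x], possibly read from array 2, so that one program
    serves both the trace norm and the moments. *)
Lemma mpo_prog_correct e m (x : R) :
    (1 < nA + nB)%N -> m 1%N = mpo_mem W 1 ->
    (forall ix, m 10%N ix = 0) -> (forall ix, m 12%N ix = 0) -> ~~ reads 0 e ->
    (forall l m', m' 2%N = m 2%N -> complex.Re (seval (env v l) m' e) = x) -> x != 0 ->
  let Q := realign nA nB (mpo_mx W) in
  exec S (mpo_prog e) v m 0%N [::] = \tr (hpow (Q ^t* *m Q) x).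
Proof.
move=> n1 m1 m10 m12 e0 ex x0 Q.
rewrite /mpo_prog; do 6! rewrite [exec S (Seqc _ _) v _]exec_Seqc.
set s1 := exec S load_mpo v m.
set s2 := exec S (run_sweep 10 _ _ _ _ _) v s1.
set s3 := exec S (run_sweep 12 _ _ _ _ _) v s2.
set s4 := exec S (factor_cmd 2) v s3.
set s5 := exec S (tensor 15 _ _ _) v s4.
set s6 := exec S (tensor 16 _ _ _) v s5.
have T5 := load_mpo_holds m1; rewrite -/s1 in T5.
have s2_10 : load_mx c.+1 s2 10 = sweep (fun i s => (site_mx W i s) ^t*) (delta_mx 0 0) nA.
  apply: (load_run_sweep S (at_ := 5) _ _ _ _ _ _ (numbers_pair R)) => //.
    by move=> ix; rewrite /s1 exec_frame // m10.
  move=> k m' kn m'5; apply: (denotes_site_adj (a := 5) (n := nA + nB) (T := site_mx W) _ _ (e := NVar 9)) => //=.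
    by move=> i s l r iN; rewrite m'5 T5.
  exact: leq_trans kn (leq_addr _ _).
have s3_12 : load_mx c.+1 s3 12 =
    sweep (fun i s => site_mx W (nA + nB - 1 - i) s) (delta_mx 0 0) nB.
  have s2_5 : s2 5%N = s1 5%N by rewrite /s2 exec_frame.
  apply: (load_run_sweep S (at_ := 5) _ _ _ _ _ _ (numbers_pair R)) => //.
    by move=> ix; rewrite /s2 exec_frame // /s1 exec_frame // m12.
  move=> k m' kn m'5.
  have -> : site_mx W (nA + nB - 1 - k) = site_mx W (neval (bind v 9 k)
    (NSub (NSub (NAdd (NVar 0) (NVar 1)) (NCst 1)) (NVar 9))) by [].
  apply: (denotes_site (n := nA + nB)) => //=; last first.
    by have lt : (nA + nB - 1 - k < nA + nB)%N by lia.
  by move=> i s l r iN; rewrite m'5 s2_5 T5.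
set G := sweep _ _ nA in s2_10; set H := sweep _ _ nB in s3_12.
have s3_10 : load_mx c.+1 s3 10 = G by rewrite -s2_10 /s3 /load_mx exec_frame.
have s4_14 := load_factor S (z := 2) (v := v) isT erefl s3_10; rewrite -/s4 in s4_14.
set F := \matrix_(i, j) _ in s4_14.
have FG : F ^t* *m F = G.
  apply: eigh_sweep_factor; apply: eighP; exact: sweep_left_herm.
have s4_12 : load_mx c.+1 s4 12 = H by rewrite -s3_12 /s4 /load_mx exec_frame.
have s5_15 : load_mx c.+1 s5 15 = F *m H by apply: load_tensor_mul.
have s5_14 : load_mx c.+1 s5 14 = F by rewrite -s4_14 /s5 /load_mx exec_frame.
have s6_16 : load_mx c.+1 s6 16 = F *m H *m F ^t* by apply: load_tensor_mul_adj.
rewrite (spectrum_output S (n := c.+1) (K := F *m H *m F ^t*) (x := x)) //; last first.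
  move=> l m' m'E; apply: ex; rewrite m'E // /s6 exec_frame // /s5 exec_frame //.
  rewrite /s4 exec_frame // /s3 exec_frame // /s2 exec_frame // /s1 exec_frame //.
have Kh : F *m H *m F ^t* \is hermsymmx.
  have Hh : H ^t* = H by apply: sweep_right_adj; exact: leq_addl.
  by apply/hermsymmxP; rewrite !adjmx_mul trmxCK Hh mulmxA.
by rewrite (mpo_hpow n1 x0 FG (eighP S Kh)).
Qed.
End Programs.

(** * Operation count for matrix product operators *)

Lemma cost_Seqc c1 c2 v : cost (Seqc c1 c2) v = (cost c1 v + cost c2 v)%N.
Proof. by []. Qed.

Lemma cost_tensor a xs ys body v :
    all nclosed xs -> all nclosed ys ->
  cost (tensor a xs ys body) v =
  (prodn (map (neval v) xs) *
     (prodn (map (neval v) ys) * (sops body).+2).+1)%N.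
Proof. exact: cost_einsum. Qed.

Lemma cost_For_const x e c v k : (forall j, cost c (bind v x j) = k) ->
  cost (For x e c) v = (neval v e * k)%N.
Proof. by move=> ck /=; under eq_bigr do rewrite ck; rewrite sum_nat_const card_ord. Qed.

Lemma cost_run_sweep a t len d z A k v : (z < 9)%N ->
    (forall e1 e2 e3, sops (A e1 e2 e3) = k) ->
  cost (run_sweep a t len d z A) v =
  (1 + neval v len * (d * v z * v z * (v z * (k + 3)).+1 +
                      v z * v z * (d * v z * (k + 4)).+1))%N.
Proof.
move=> z9 Ak; rewrite cost_Seqc; congr addn.
have z10 := leqW z9.
apply: cost_For_const => j; rewrite cost_Seqc !cost_tensor /= ?z10 // !Ak.
have -> : bind v 9 j z = v z by rewrite /bind ltn_eqF.
rewrite !muln1 !mulnA; congr (_ * _.+1 + _ * _.+1)%N; congr (_ * _)%N; lia.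
Qed.

Lemma cost_factor_cmd z v : (z < 9)%N ->
  cost (factor_cmd z) v = (v z ^ 3 + v z * v z * 7)%N.
Proof.
move=> z9; rewrite cost_Seqc cost_tensor //= ?(leqW z9) //.
lia.
Qed.

Lemma cost_spectrum_cmd D a e v : nclosed D ->
  cost (spectrum_cmd D a e) v = (neval v D ^ 3 + (neval v D * (sops e + 3)).+1)%N.
Proof.
move=> cD; rewrite cost_Seqc cost_tensor //= ?cD //.
lia.
Qed.

Lemma cost_mpo_prog e nA nB chi : (0 < chi)%N -> (1 < nA + nB)%N ->
  (cost (mpo_prog e) (params [:: nA; nB; chi]) <= (sops e + 100) * ((nA + nB) * chi ^ 3))%N.
Proof.
move=> chi0 n1; rewrite /mpo_prog; do 6! rewrite cost_Seqc.
rewrite cost_einsum // (@cost_run_sweep 10 _ _ _ _ _ 1) // (@cost_run_sweep 12 _ _ _ _ _ 0) //.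
rewrite cost_factor_cmd //.
rewrite ?cost_spectrum_cmd // !cost_tensor //=.
have yE : (chi * chi * chi = chi ^ 3)%N by rewrite !expnS expn0 muln1 mulnA.
have x2 : (chi * chi <= chi ^ 3)%N by rewrite -yE leq_pmulr.
have x1 : (chi <= chi ^ 3)%N by apply: leq_trans x2; rewrite leq_pmulr.
have nAx := leq_mul (leqnn nA) x2; have nBx := leq_mul (leqnn nB) x2.
have sx := leq_mul (leqnn (sops e)) x1.
(* Contributions free of the number of sites, such as the two eigendecompositions, are absorbed
   through [n1]. *)
have y2 : (2 * chi ^ 3 <= (nA + nB) * chi ^ 3)%N by rewrite leq_mul.
have sy := leq_mul (leqnn (sops e)) y2.
have y1 : (0 < chi ^ 3)%N by rewrite expn_gt0 chi0.
have nAy : (nA * (chi * chi * chi) = nA * chi ^ 3)%N by rewrite yE.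
have nBy : (nB * (chi * chi * chi) = nB * chi ^ 3)%N by rewrite yE.
(* With the cube abstracted, each lower monomial is bounded by a multiple of [y] and the goal is
   linear. *)
move: (chi ^ 3)%N x2 x1 nAx nBx sx y2 sy y1 yE nAy nBy => y x2 x1 nAx nBx sx y2 sy y1 yE nAy nBy.
lia.
Qed.

(** * Matrix product states *)

Local Notation chi := (NVar 3).
Local Notation chi4 := [:: NVar 3; NVar 3; NVar 3; NVar 3].

Definition mps_left : cmd :=
  run_sweep 10 11 (NVar 0) 2 3 (fun s x y => SConj (SGet 1 [:: NVar 9; s; y; x])).

Definition mps_right : cmd :=
  run_sweep 12 13 (NVar 2) 2 3 (fun s x y =>
    SGet 1 [:: NSub (NSub (NAdd (NAdd (NVar 0) (NVar 1)) (NVar 2)) (NCst 1)) (NVar 9); s; x; y]).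

(* Array 30: [sum_b N_b[p,m] conj N_b[q,n]] at [m, n, p, q], with [N_b] the product of [F]
   and the site matrices of [b]. *)
Definition transfer_step : cmd :=
  Seqc (pair_step 30 32 31 (NCst 2) chi
         (fun s x y => SGet 1 [:: NAdd (NVar 0) (NVar 9); s; y; x]))
       (tensor 30 chi4 [::] (SGet 31 [:: NVar 12; NVar 13; NVar 10; NVar 11])).

Definition pair_gram : cmd :=
  einsum 40 [:: NAdd (NMul (NVar 10) chi) (NVar 11); NAdd (NMul (NVar 12) chi) (NVar 13)]
    chi4 [:: chi; chi]
    (SMul (SGet 31 [:: NVar 10; NVar 12; NVar 14; NVar 15])
          (SConj (SGet 30 [:: NVar 14; NVar 15; NVar 11; NVar 13]))).

Definition mps_ccnr_prog : cmd :=
  Seqc mps_left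
  (Seqc mps_right
  (Seqc (factor_cmd 3)
  (Seqc (tensor 30 chi4 [::]
     (SMul (SGet 14 [:: NVar 12; NVar 10]) (SConj (SGet 14 [:: NVar 13; NVar 11]))))
  (Seqc (For 9 (NVar 1) transfer_step)
  (Seqc (pair_step 30 32 31 (NCst 1) chi (fun s x y => SGet 12 [:: y; x]))
  (Seqc pair_gram
  (Seqc (spectrum_cmd (NMul chi chi) 40 shalf)
  (Assign 0 [::] (SLn (SGet 0 [::])))))))))).

(* Array 30: [sum_b P_b[x,z] conj P_b[y,w]] at [x, y, z, w], where [b = (b1, b2)] and
   [P_b = M_b1^* G M_b2] for the products [M_b1], [M_b2] of site matrices.  Moving the four
   legs one at a time costs [chi ^ 5] per site; no [chi ^ 6] contraction occurs. *)
Definition double_transfer_step : cmd :=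
  Seqc (pair_step 30 32 31 (NCst 2) chi
         (fun s x y => SConj (SGet 1 [:: NAdd (NVar 0) (NVar 9); s; y; x])))
       (pair_step 31 32 30 (NCst 2) chi
         (fun s x y => SGet 1 [:: NAdd (NVar 0) (NVar 9); s; y; x])).

Definition mps_moment4_prog : cmd :=
  Seqc mps_left
  (Seqc mps_right
  (Seqc (tensor 30 chi4 [::]
     (SMul (SGet 10 [:: NVar 10; NVar 12]) (SConj (SGet 10 [:: NVar 11; NVar 13]))))
  (Seqc (For 9 (NVar 1) double_transfer_step)
  (Seqc (pair_step 30 32 31 (NCst 1) chi (fun s x y => SGet 12 [:: x; y]))
  (Seqc (pair_step 31 32 33 (NCst 1) chi (fun s x y => SGet 12 [:: y; x]))
  (tensor 0 [::] chi4
     (SMul (SGet 33 [:: NVar 10; NVar 11; NVar 12; NVar 13])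
           (SConj (SGet 30 [:: NVar 10; NVar 11; NVar 12; NVar 13]))))))))).

Section Programs.
Variables (R : realType) (S : dense_solver R).
Local Notation C := R[i].
Variables (nA nB nC c : nat) (A : mps R (nA + nB + nC) c.+1).
Local Notation M := 'M[C]_c.+1.
Let v := params [:: nA; nB; nC; c.+1].
Let T := site_mx A.
Let n := (nA + nB + nC)%N.
Let G := sweep (fun i s => (T i s) ^t*) (delta_mx 0 0) nA.
Let Gam := sweep (fun i s => T (n - 1 - i)%N s) (delta_mx 0 0) nC.

Definition holds4 (J : finType) (m : Defs.mem R) a (P : J -> M) :=
  forall x y z w : 'I_c.+1, m a [:: val x; val y; val z; val w] = tens P x y z w.

Lemma mps_mem_holds : holds nat_of_bool (mps_mem A) 1 T n.
Proof. by move=> i s l r _; rewrite /T mxE /=; case: s. Qed.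

Lemma holds_eq m : m 1%N = mps_mem A 1 -> holds nat_of_bool m 1 T n.
Proof. by move=> m1 i s l r iN; rewrite m1 mps_mem_holds. Qed.

Lemma load_mps_left m : m 1%N = mps_mem A 1 -> (forall ix, m 10%N ix = 0) ->
  load_mx c.+1 (exec S mps_left v m) 10 = G.
Proof.
move=> m1 m10; apply: (load_run_sweep S (at_ := 1) _ _ _ _ _ _ (numbers_bool R)) => //.
move=> k m' kn m'1.
apply: (denotes_site_adj (a := 1) (n := n) (T := T) _ _ (e := NVar 9)) => //=.
  by apply: holds_eq; rewrite m'1.
exact: leq_trans kn (leq_trans (leq_addr _ _) (leq_addr _ _)).
Qed.

Lemma load_mps_right m : m 1%N = mps_mem A 1 -> (forall ix, m 12%N ix = 0) ->
  load_mx c.+1 (exec S mps_right v m) 12 = Gam.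
Proof.
move=> m1 m12; apply: (load_run_sweep S (at_ := 1) _ _ _ _ _ _ (numbers_bool R)) => //.
move=> k m' kn m'1.
have -> : T (n - 1 - k) = T (neval (bind v 9 k)
  (NSub (NSub (NAdd (NAdd (NVar 0) (NVar 1)) (NVar 2)) (NCst 1)) (NVar 9))) by [].
apply: (denotes_site (n := n)) => //=; last first.
  have kC : (k < nC)%N := kn.
  by have lt : (n - 1 - k < n)%N by rewrite /n; lia.
by apply: holds_eq; rewrite m'1.
Qed.

Lemma pair_step_holds4 (I J : finType) (enc : I -> nat) a t b d B Am (P : J -> M) u m :
    a != t -> b != t -> nclosed d -> u 3%N = c.+1 ->
    numbers R enc (neval u d) -> denotes enc u m [:: t; b] B Am -> holds4 m a P ->
  holds4 (exec S (pair_step a t b d chi B) u m) b (fun sj : I * J => (Am sj.1 *m P sj.2)^T).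
Proof.
move=> at_ bt cd uc numd dB mP z w x y.
have uc' : neval u chi = c.+1 := uc.
rewrite (pair_step_tens S at_ bt cd _ uc' numd dB mP) //.
by apply: eq_bigr => j _; rewrite !mxE.
Qed.

Lemma exec_pair_step_frame a t b d u m B b' :
  b' != t -> b' != b -> exec S (pair_step a t b d chi B) u m b' = m b'.
Proof.
move=> /negPf bt /negPf bb; apply: exec_frame.
by rewrite writes_Seqc !writes_tensor !inE bt bb.
Qed.

Lemma eq_holds4 (J J' : finType) m a (P : J -> M) (P' : J' -> M) :
    (forall x y z w, tens P x y z w = tens P' x y z w) ->
  holds4 m a P -> holds4 m a P'.
Proof. by move=> PP mP x y z w; rewrite mP PP. Qed.

(** Multiplying the transpose of N_b by the transposed site matrix from the left extends the word on
    the right. One pair step leaves its result transposed, which the final copy undoes. *)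
Lemma transfer_step_holds4 k m (F : M) :
    (k < nB)%N -> m 1%N = mps_mem A 1 ->
    holds4 m 30 (fun w : k.-tuple bool => (F *m mprod T nA w)^T) ->
  holds4 (exec S transfer_step (bind v 9 k) m) 30
    (fun w : k.+1.-tuple bool => (F *m mprod T nA w)^T).
Proof.
move=> kB m1 mP; rewrite /transfer_step exec_Seqc.
have dB : denotes (R := R) nat_of_bool (bind v 9 k) m [:: 32; 31]
    (fun s x y => SGet 1 [:: NAdd (NVar 0) (NVar 9); s; y; x]) (fun s => (T (nA + k) s)^T).
  apply: (denotes_site_tr (a := 1) (n := n) (T := T) _ _ (e := NAdd (NVar 0) (NVar 9))) => //.
    exact: holds_eq.
  by have lt : (nA + k < n)%N by rewrite /n; lia.
have m31 := pair_step_holds4 (u := bind v 9 k) (d := NCst 2) (a := 30) (t := 32) (b := 31)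
  isT isT isT erefl (numbers_bool R) dB mP.
move: (exec _ _ _ _) m31 => m' m31 x y z w.
rewrite exec_tensor //= !ltn_ord /= !envE m31 /tens.
rewrite (big_tuple_rcons _ (fun w0 => (F *m mprod T nA w0)^T x z *
  ((F *m mprod T nA w0)^T y w)^*%R)).
rewrite -(pair_bigA _ (fun s (t : k.-tuple bool) =>
  ((T (nA + k) s)^T *m (F *m mprod T nA t)^T)^T z x *
  (((T (nA + k) s)^T *m (F *m mprod T nA t)^T)^T w y)^*%R)) /=.
apply: eq_bigr => s _; apply: eq_bigr => t _.
by rewrite mprod_rcons size_tuple -!trmx_mul !trmxK mulmxA !mxE.
Qed.

Lemma double_transfer_step_holds4 k m :
    let P k (b : k.-tuple bool * k.-tuple bool) :=
      (mprod T nA b.1) ^t* *m G *m mprod T nA b.2 in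
    (k < nB)%N -> m 1%N = mps_mem A 1 -> holds4 m 30 (P k) ->
  holds4 (exec S double_transfer_step (bind v 9 k) m) 30 (P k.+1).
Proof.
move=> P kB m1 mP; rewrite /double_transfer_step exec_Seqc.
have ltn : (nA + k < n)%N by rewrite /n; lia.
have dB : denotes (R := R) nat_of_bool (bind v 9 k) m [:: 32; 31]
    (fun s x y => SConj (SGet 1 [:: NAdd (NVar 0) (NVar 9); s; y; x]))
    (fun s => (T (nA + k) s) ^t*).
  apply: (denotes_site_adj (a := 1) (n := n) (T := T) _ _ (e := NAdd (NVar 0) (NVar 9))) => //.
  exact: holds_eq.
have m31 := pair_step_holds4 (u := bind v 9 k) (d := NCst 2) (a := 30) (t := 32) (b := 31)
  isT isT isT erefl (numbers_bool R) dB mP.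
have m'1 : exec S (pair_step 30 32 31 (NCst 2) chi (fun s x y =>
  SConj (SGet 1 [:: NAdd (NVar 0) (NVar 9); s; y; x]))) (bind v 9 k) m 1%N = mps_mem A 1.
  by rewrite exec_pair_step_frame.
move: (exec _ _ _ _) m31 m'1 => m' m31 m'1.
have dB' : denotes (R := R) nat_of_bool (bind v 9 k) m' [:: 32; 30]
    (fun s x y => SGet 1 [:: NAdd (NVar 0) (NVar 9); s; y; x]) (fun s => (T (nA + k) s)^T).
  apply: (denotes_site_tr (a := 1) (n := n) (T := T) _ _ (e := NAdd (NVar 0) (NVar 9))) => //.
  exact: holds_eq.
have := pair_step_holds4 (u := bind v 9 k) (d := NCst 2) (a := 31) (t := 32) (b := 30)
  isT isT isT erefl (numbers_bool R) dB' m31.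
apply: eq_holds4 => x y z w; rewrite /tens.
pose f (w1 w2 : seq bool) := ((mprod T nA w1) ^t* *m G *m mprod T nA w2) x z *
  (((mprod T nA w1) ^t* *m G *m mprod T nA w2) y w)^*%R.
transitivity (\sum_s2 \sum_s1 \sum_(b1 : k.-tuple bool) \sum_(b2 : k.-tuple bool)
    f (rcons b1 s1) (rcons b2 s2)).
  rewrite pair_bigA; rewrite [RHS](eq_bigr (fun s => \sum_(b : k.-tuple bool * k.-tuple bool)
    f (rcons b.1 s.2) (rcons b.2 s.1))) => [|s _]; last by rewrite pair_bigA.
  rewrite pair_bigA (reindex (fun j : bool * bool * (k.-tuple bool * k.-tuple bool) =>
    (j.1.1, (j.1.2, j.2)))) /=; last first.
    by exists (fun j => (j.1, j.2.1, j.2.2)) => [[[]]|[? []]].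
  apply: eq_bigr => -[[s2 s1] [b1 b2]] _ /=.
  rewrite /f /P !mprod_rcons !size_tuple /= adjmx_mul.
  by rewrite -!trmx_mul !trmxK !mulmxA.
rewrite exchange_big -(pair_bigA _ (fun b1 b2 : k.+1.-tuple bool => f b1 b2)) /=.
rewrite (big_tuple_rcons _ (fun w1 => \sum_(b2 : k.+1.-tuple bool) f w1 b2)).
apply: eq_bigr => s1 _; rewrite exchange_big; apply: eq_bigr => b1 _.
by rewrite (big_tuple_rcons _ (f (rcons b1 s1))).
Qed.

Lemma load_pair_gram u m (K : 'M[C]_(c.+1 * c.+1)) : u 3%N = c.+1 ->
    (forall i j, K i j = \sum_(x < c.+1) \sum_(y < c.+1)
       m 31%N [:: val (hi i); val (hi j); val x; val y] *
       (m 30%N [:: val x; val y; val (lo i); val (lo j)])^*%R) ->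
  load_mx (c.+1 * c.+1) (exec S pair_gram u m) 40 = K.
Proof.
move=> uc KE; apply/matrixP => i j; rewrite KE mxE.
pose g ix := if ix is [:: k; l] then
  if inrange [:: c.+1 * c.+1; c.+1 * c.+1]%N ix
    then Some [:: k %/ c.+1; k %% c.+1; l %/ c.+1; l %% c.+1]%N else None else None.
rewrite /pair_gram (@exec_einsum _ _ _ _ _ _ _ _ g) //=.
- rewrite !ltn_ord /= !uc /=; apply: eq_bigr => x _; apply: eq_bigr => y _.
  by rewrite !envE /hi /lo !inordK ?ltn_pmod ?ltn_divLR.
- by case=> [|? [|? [|? [|? []]]]].
move=> ix l; rewrite /= !uc; split.
  case: ix => [|k0 [|l0 []]] //=; case: ifP => // /and3P[k0l l0l _] [<-] /=.
  rewrite !envE /env /= uc -!divn_eq; split=> //.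
  by rewrite !ltn_divLR ?ltn_pmod // k0l l0l.
case: l => [|p [|p' [|q [|q' []]]]] /=; rewrite ?andbF; try by case.
  2: by move=> ? ? [].
case=> /andP[pc /andP[p'c /andP[qc /andP[q'c _]]]] <-; rewrite !envE /env /= uc.
rewrite (_ : p * c.+1 + p' < c.+1 * c.+1)%N; last by nia.
rewrite (_ : q * c.+1 + q' < c.+1 * c.+1)%N; last by nia.
by rewrite !divnMDl // !divn_small // !addn0 !modnMDl !modn_small.
Qed.

Lemma mps_ccnr_prog_correct m :
    (1 < nA + nB + nC)%N -> m 1%N = mps_mem A 1 ->
    (forall ix, m 10%N ix = 0) -> (forall ix, m 12%N ix = 0) ->
  exec S mps_ccnr_prog v m 0%N [::] = (ccnr_negativity nA nB (reduced (mps_ket A)))%:C.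
Proof.
move=> n1 m1 m10 m12; rewrite /mps_ccnr_prog.
do 8! rewrite [exec S (Seqc _ _) v _]exec_Seqc.
set s1 := exec S mps_left v m.
set s2 := exec S mps_right v s1.
set s3 := exec S (factor_cmd 3) v s2.
set s4 := exec S (tensor 30 _ _ _) v s3.
set s5 := exec S (For _ _ _) v s4.
set s6 := exec S (pair_step _ _ _ _ _ _) v s5.
set s7 := exec S pair_gram v s6.
have s1_1 : s1 1%N = mps_mem A 1 by rewrite /s1 exec_frame.
have s2_1 : s2 1%N = mps_mem A 1 by rewrite /s2 exec_frame.
have s3_1 : s3 1%N = mps_mem A 1 by rewrite /s3 exec_frame.
have s4_1 : s4 1%N = mps_mem A 1 by rewrite /s4 exec_frame.
have s1_12 ix : s1 12%N ix = 0 by rewrite /s1 exec_frame.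
have s1_10 := load_mps_left m1 m10; rewrite -/s1 in s1_10.
have s2_12 := load_mps_right s1_1 s1_12; rewrite -/s2 in s2_12.
have s2_10 : load_mx c.+1 s2 10 = G by rewrite -s1_10 /s2 /load_mx exec_frame.
have s3_14 := load_factor S (z := 3) (v := v) isT erefl s2_10; rewrite -/s3 in s3_14.
set F := \matrix_(i, j) _ in s3_14.
have FG : F ^t* *m F = G by apply: eigh_sweep_factor; apply: eighP; exact: sweep_left_herm.
have s4_30 : holds4 s4 30 (fun w : 0.-tuple bool => (F *m mprod T nA w)^T).
  move=> x y z w; rewrite /s4 exec_tensor //= !ltn_ord /= !envE /tens.
  rewrite (big_tuple0 (fun t => (F *m mprod T nA t)^T x z * ((F *m mprod T nA t)^T y w)^*%R)).
  by rewrite /= mulmx1 -s3_14 !mxE.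
have [s5_1 s5_30] : s5 1%N = mps_mem A 1 /\
    holds4 s5 30 (fun w : nB.-tuple bool => (F *m mprod T nA w)^T).
  pose P k (m' : Defs.mem R) := m' 1%N = mps_mem A 1 /\
    holds4 m' 30 (fun w : k.-tuple bool => (F *m mprod T nA w)^T).
  apply: (@exec_For_ind _ S P) => // k m' kB [m'1 m'30]; split.
    by rewrite exec_frame.
  exact: transfer_step_holds4.
have s5_12 : load_mx c.+1 s5 12 = Gam.
  rewrite -s2_12 /load_mx /s5 exec_frame //.
  by rewrite /s4 exec_frame // /s3 exec_frame.
(* Array 30 is left intact: the Gram matrix contracts the tensor with [Gam] against the one
   without. *)
have s6_31 : holds4 s6 31 (fun w : nB.-tuple bool => F *m mprod T nA w *m Gam).
  have dG := denotes_mx_tr v (ws := [:: 32; 31]) (a := 12) isT (fun=> 0%N) s5_12.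
  have := pair_step_holds4 (u := v) (d := NCst 1) (a := 30) (t := 32) (b := 31)
    isT isT isT erefl (numbers_unit R) dG s5_30.
  rewrite -/s6; apply: eq_holds4 => x y z w; rewrite /tens.
  rewrite -(pair_bigA _ (fun (s : unit) (t : nB.-tuple bool) =>
    (Gam^T *m (F *m mprod T nA t)^T)^T x z *
    ((Gam^T *m (F *m mprod T nA t)^T)^T y w)^*%R)) /=.
  rewrite (big_pred1 tt) => [|[]] //; apply: eq_bigr => t _.
  by rewrite -trmx_mul trmxK.
have s6_30 : holds4 s6 30 (fun w : nB.-tuple bool => (F *m mprod T nA w)^T).
  by move=> x y z w; rewrite /s6 exec_pair_step_frame // s5_30.
pose X (b : nB.-tuple bool * nB.-tuple bool) :=
  mprod T nA b.1 *m Gam *m (mprod T nA b.2) ^t*.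
pose K := \matrix_(i, j) \sum_b (F *m X b *m F ^t*) (hi i) (lo i) *
                               ((F *m X b *m F ^t*) (hi j) (lo j))^*%R.
have KE i j : K i j = \sum_b (F *m X b *m F ^t*) (hi i) (lo i) *
    ((F *m X b *m F ^t*) (hi j) (lo j))^*%R by rewrite mxE.
have s7_40 : load_mx (c.+1 * c.+1) s7 40 = K.
  apply: load_pair_gram => // i j; rewrite KE -mps_gram_entry.
  by apply: eq_bigr => x _; apply: eq_bigr => y _; rewrite s6_31 s6_30.
have half0 : (2^-1 : R) != 0 by rewrite invr_eq0 pnatr_eq0.
have [Kh trE] := mps_hpow n1 (eigh S K) half0 FG KE.
rewrite /ccnr_negativity /trace_norm (trE (eighP S Kh)).
have out : exec S (spectrum_cmd (NMul chi chi) 40 shalf) v s7 0%N [::] =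
    \sum_i (((eigh S K).2 0 i) `^ 2^-1)%:C.
  apply: spectrum_output => // l m' _; exact: Re_half.
rewrite -out.
by [].
Qed.

Lemma mps_moment4_prog_correct m :
    (1 < nA + nB + nC)%N -> m 1%N = mps_mem A 1 ->
    (forall ix, m 10%N ix = 0) -> (forall ix, m 12%N ix = 0) ->
  exec S mps_moment4_prog v m 0%N [::] = realign_moment nA nB 4 (reduced (mps_ket A)).
Proof.
move=> n1 m1 m10 m12; rewrite /mps_moment4_prog.
do 6! rewrite [exec S (Seqc _ _) v _]exec_Seqc.
set s1 := exec S mps_left v m.
set s2 := exec S mps_right v s1.
set s3 := exec S (tensor 30 _ _ _) v s2.
set s4 := exec S (For _ _ _) v s3.
set s5 := exec S (pair_step 30 _ _ _ _ _) v s4.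
set s6 := exec S (pair_step 31 _ _ _ _ _) v s5.
have s1_1 : s1 1%N = mps_mem A 1 by rewrite /s1 exec_frame.
have s2_1 : s2 1%N = mps_mem A 1 by rewrite /s2 exec_frame.
have s3_1 : s3 1%N = mps_mem A 1 by rewrite /s3 exec_frame.
have s1_12 ix : s1 12%N ix = 0 by rewrite /s1 exec_frame.
have s1_10 := load_mps_left m1 m10; rewrite -/s1 in s1_10.
have s2_12 := load_mps_right s1_1 s1_12; rewrite -/s2 in s2_12.
have s2_10 : load_mx c.+1 s2 10 = G by rewrite -s1_10 /s2 /load_mx exec_frame.
pose P k (b : k.-tuple bool * k.-tuple bool) :=
  (mprod T nA b.1) ^t* *m G *m mprod T nA b.2.
have s3_30 : holds4 s3 30 (P 0).
  move=> x y z w; rewrite /s3 exec_tensor //= !ltn_ord /= !envE /tens.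
  rewrite (big_pred1 ([tuple], [tuple])) => [|[b b']]; last first.
    by rewrite [b]tuple0 [b']tuple0; apply/esym/eqP.
  by rewrite /P /= trmx1 map_mx1 mul1mx mulmx1 -s2_10 !mxE.
have [s4_1 s4_30] : s4 1%N = mps_mem A 1 /\ holds4 s4 30 (P nB).
  pose Inv k (m' : Defs.mem R) := m' 1%N = mps_mem A 1 /\ holds4 m' 30 (P k).
  apply: (@exec_For_ind _ S Inv) => // k m' kB [m'1 m'30]; split.
    by rewrite exec_frame.
  exact: double_transfer_step_holds4.
have s4_12 : load_mx c.+1 s4 12 = Gam.
  by rewrite -s2_12 /load_mx /s4 exec_frame // /s3 exec_frame.
have dG := denotes_mx v (ws := [:: 32; 31]) (a := 12) isT (fun=> 0%N) s4_12.
have s5_31 := pair_step_holds4 (u := v) (d := NCst 1) (a := 30) (t := 32) (b := 31)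
  isT isT isT erefl (numbers_unit R) dG s4_30; rewrite -/s5 in s5_31.
have s5_12 : load_mx c.+1 s5 12 = Gam by rewrite -s4_12 /load_mx /s5 exec_pair_step_frame.
have dG' := denotes_mx_tr v (ws := [:: 32; 33]) (a := 12) isT (fun=> 0%N) s5_12.
have s6_33 := pair_step_holds4 (u := v) (d := NCst 1) (a := 31) (t := 32) (b := 33)
  isT isT isT erefl (numbers_unit R) dG' s5_31; rewrite -/s6 in s6_33.
(* [Gam] is applied on the left, then through its transpose on the right; array 30 still holds the
   tensor without it. *)
have s6_33' : holds4 s6 33 (fun b => Gam *m P nB b *m Gam).
  move: s6_33; apply: eq_holds4 => x y z w; rewrite /tens.
  rewrite (reindex (fun b => (tt, (tt, b)))) /=; last first.
    by exists (fun j => j.2.2) => [b|[[] [[] b]]].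
  by apply: eq_bigr => b _; rewrite -trmx_mul trmxK.
have s6_30 : holds4 s6 30 (P nB).
  move=> x y z w; rewrite /s6 exec_pair_step_frame // /s5 exec_pair_step_frame //.
rewrite /realign_moment (_ : 4 / 2 = 2 :> R); last by field.
rewrite mps_moment4 // exec_tensor //=.
apply: eq_bigr => x _; apply: eq_bigr => y _; apply: eq_bigr => z _; apply: eq_bigr => w _.
by rewrite /= !envE s6_33' s6_30.
Qed.

End Programs.

(** * Operation counts for matrix product states *)

Lemma cost_pair_step a t b d B k u : nclosed d -> (forall e1 e2 e3, sops (B e1 e2 e3) = k) ->
  cost (pair_step a t b d chi B) u =
  (neval u d * u 3 ^ 4 * (u 3 * (k + 3)).+1 + u 3 ^ 4 * (neval u d * u 3 * (k + 4)).+1)%N.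
Proof.
move=> cd Bk; rewrite cost_Seqc !cost_tensor /= ?cd // !Bk !expnS expn0.
congr (_ * _.+1 + _ * _.+1)%N; lia.
Qed.

Lemma cost_transfer_step u x : u 3%N = x ->
  cost transfer_step u = (2 * x ^ 4 * (x * 3).+1 + x ^ 4 * (2 * x * 4).+1 + x ^ 4 * 3)%N.
Proof.
move=> <-; rewrite cost_Seqc (@cost_pair_step _ _ _ _ _ 0) // cost_tensor //=.
congr addn; rewrite !expnS expn0; lia.
Qed.

Lemma cost_double_transfer_step u x : u 3%N = x ->
  cost double_transfer_step u =
    (2 * x ^ 4 * (x * 4).+1 + x ^ 4 * (2 * x * 5).+1 +
     (2 * x ^ 4 * (x * 3).+1 + x ^ 4 * (2 * x * 4).+1))%N.
Proof.
by move=> <-; rewrite cost_Seqc (@cost_pair_step 30 _ _ _ _ 1) // (@cost_pair_step 31 _ _ _ _ 0).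
Qed.

Lemma cost_mps_sweeps nA nB nC x :
  let u := params [:: nA; nB; nC; x] in
  (cost mps_left u + cost mps_right u =
   2 + nA * (2 * x * x * (x * 4).+1 + x * x * (2 * x * 5).+1)
     + nC * (2 * x * x * (x * 3).+1 + x * x * (2 * x * 4).+1))%N.
Proof.
rewrite /mps_left /mps_right (@cost_run_sweep 10 _ _ _ _ _ 1) // (@cost_run_sweep 12 _ _ _ _ _ 0) //=.
lia.
Qed.

(** The sixth power has two sources, the contraction in [pair_gram] and the eigendecomposition in
    dimension chi^2; neither is repeated along the chain. *)
Lemma cost_mps_ccnr_prog nA nB nC x : (0 < x)%N -> (1 < nA + nB + nC)%N ->
  (cost mps_ccnr_prog (params [:: nA; nB; nC; x])
     <= 100 * (x ^ 6 + (nA + nB + nC) * x ^ 5))%N.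
Proof.
move=> x0 n1; rewrite /mps_ccnr_prog; do 8! rewrite cost_Seqc.
rewrite addnA cost_mps_sweeps cost_factor_cmd // cost_spectrum_cmd //.
set u := params _; have loopE j : cost transfer_step (bind u 9 j) = _ := cost_transfer_step (erefl x).
rewrite (cost_For_const _ loopE) /u {u loopE}.
rewrite (@cost_pair_step _ _ _ _ _ 0) // cost_tensor // cost_einsum //=.
have le k : (k <= 5)%N -> (x ^ k <= x ^ 5)%N by move=> ?; rewrite leq_pexp2l.
have le0 := le 0%N isT; have le1 := le 1%N isT; have le2 := le 2%N isT.
have le3 := le 3%N isT; have le4 := le 4%N isT.
have nA2 := leq_mul (leqnn nA) le2; have nA3 := leq_mul (leqnn nA) le3.
have nC2 := leq_mul (leqnn nC) le2; have nC3 := leq_mul (leqnn nC) le3.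
have nB4 := leq_mul (leqnn nB) le4.
have n5 : (2 * x ^ 5 <= (nA + nB + nC) * x ^ 5)%N by rewrite leq_mul.
move: le0 le1 le2 le3 le4 nA2 nA3 nC2 nC3 nB4 n5; rewrite !expnS !expn0 !muln1 {le}.
lia.
Qed.

(** No contraction runs over more than five bond indices, and those outside the site loops are
    absorbed by the factor of at least two sites. *)
Lemma cost_mps_moment4_prog nA nB nC x : (0 < x)%N -> (1 < nA + nB + nC)%N ->
  (cost mps_moment4_prog (params [:: nA; nB; nC; x])
     <= 100 * ((nA + nB + nC) * x ^ 5))%N.
Proof.
move=> x0 n1; rewrite /mps_moment4_prog; do 6! rewrite cost_Seqc.
rewrite addnA cost_mps_sweeps.
set u := params _; have loopE j : cost double_transfer_step (bind u 9 j) = _ := cost_double_transfer_step (erefl x).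
rewrite (cost_For_const _ loopE) /u {u loopE}.
rewrite (@cost_pair_step 30 _ _ _ _ 0) // (@cost_pair_step 31 _ _ _ _ 0) // !cost_tensor //=.
have le k : (k <= 5)%N -> (x ^ k <= x ^ 5)%N by move=> ?; rewrite leq_pexp2l.
have le0 := le 0%N isT; have le1 := le 1%N isT; have le2 := le 2%N isT.
have le3 := le 3%N isT; have le4 := le 4%N isT.
have nA2 := leq_mul (leqnn nA) le2; have nA3 := leq_mul (leqnn nA) le3.
have nC2 := leq_mul (leqnn nC) le2; have nC3 := leq_mul (leqnn nC) le3.
have nB4 := leq_mul (leqnn nB) le4.
have n5 : (2 * x ^ 5 <= (nA + nB + nC) * x ^ 5)%N by rewrite leq_mul.
move: le0 le1 le2 le3 le4 nA2 nA3 nC2 nC3 nB4 n5; rewrite !expnS !expn0 !muln1 {le}.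
lia.
Qed.

Lemma train_val0 (R : realType) (I : Type) n (A : train R I n 0) f : train_val A f = 0.
Proof. by rewrite /train_val mxE big_ord0. Qed.

(** A train of bond dimension 0 is identically 0, against trace 1. This case must be excluded: the
    cost bound would be 0 there, while the program still makes assignments. *)
Lemma mpo_bond_gt0 (R : realType) n chi (W : mpo R n chi) :
  density_matrix (mpo_mx W) -> (0 < chi)%N.
Proof.
case: chi W => // W [_ _]; rewrite /mxtrace big1 => [/eqP|i _].
  by rewrite eq_sym oner_eq0.
by rewrite mxE train_val0.
Qed.

Lemma mps_bond_gt0 (R : realType) n chi (A : mps R n chi) :
  normalized (mps_ket A) -> (0 < chi)%N.
Proof.
case: chi A => // A; rewrite /normalized big1 => [/eqP|s _].
  by rewrite eq_sym oner_eq0.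
by rewrite /mps_ket train_val0 normr0 expr0n.
Qed.

Theorem mainTheorem16 (R : realType) :
  (* (i), CCNR negativity *)
  (exists (P : cmd) (K : nat),
    forall (sol : dense_solver R) (nA nB chi : nat) (W : mpo R (nA + nB) chi),
      (1 < nA + nB)%N ->
      density_matrix (mpo_mx W) ->
      output sol P [:: nA; nB; chi] (mpo_mem W)
        = (ccnr_negativity nA nB (mpo_mx W))%:C /\
      (cost P (params [:: nA; nB; chi]) <= K * ((nA + nB) * chi ^ 3))%N) /\
  (* (i), realignment moments *)
  (exists (P : cmd) (K : nat),
    forall (sol : dense_solver R) (nA nB chi : nat) (W : mpo R (nA + nB) chi)
           (alpha : R),
      (1 < nA + nB)%N ->
      density_matrix (mpo_mx W) ->
      0 < alpha ->
      output sol P [:: nA; nB; chi] (with_scalar (mpo_mem W) alpha)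
        = realign_moment nA nB alpha (mpo_mx W) /\
      (cost P (params [:: nA; nB; chi]) <= K * ((nA + nB) * chi ^ 3))%N) /\
  (* (ii), CCNR negativity *)
  (exists (P : cmd) (K : nat),
    forall (sol : dense_solver R) (nA nB nC chi : nat)
           (A : mps R (nA + nB + nC) chi),
      (1 < nA + nB + nC)%N ->
      normalized (mps_ket A) ->
      output sol P [:: nA; nB; nC; chi] (mps_mem A)
        = (ccnr_negativity nA nB (reduced (mps_ket A)))%:C /\
      (cost P (params [:: nA; nB; nC; chi])
         <= K * (chi ^ 6 + (nA + nB + nC) * chi ^ 5))%N) /\
  (* (ii), fourth realignment moment *)
  (exists (P : cmd) (K : nat),
    forall (sol : dense_solver R) (nA nB nC chi : nat)
           (A : mps R (nA + nB + nC) chi),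
      (1 < nA + nB + nC)%N ->
      normalized (mps_ket A) ->
      output sol P [:: nA; nB; nC; chi] (mps_mem A)
        = realign_moment nA nB 4 (reduced (mps_ket A)) /\
      (cost P (params [:: nA; nB; nC; chi])
         <= K * ((nA + nB + nC) * chi ^ 5))%N).
Proof.
do ! split.
(* [cost_mpo_prog] contributes 101, as [shalf] takes one operation; the final logarithm and its
   assignment cost 2 more, covered with room to spare. *)
- exists (Seqc (mpo_prog shalf) (Assign 0 [::] (SLn (SGet 0 [::])))), 104%N.
  move=> sol nA nB chi W n1 rhoW; have := mpo_bond_gt0 rhoW.
  case: chi W rhoW => // c W _ _; split.
    have half0 : (2^-1 : R) != 0 by rewrite invr_eq0 pnatr_eq0.
    rewrite /output exec_Seqc /ccnr_negativity /trace_norm.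
    by rewrite -(mpo_prog_correct sol (e := shalf) (m := mpo_mem W) n1 _ _ _ _
      (fun l m' _ => Re_half _ m') half0).
  have := cost_mpo_prog shalf (ltn0Sn c) n1; rewrite cost_Seqc.
  have : (0 < (nA + nB) * c.+1 ^ 3)%N by rewrite muln_gt0 expn_gt0 andbT ltnW.
  rewrite -[sops shalf]/1%N -[cost (Assign _ _ _) _]/2%N.
  by move: (cost _ _) (_ * _ ^ 3)%N => k N N0 kN; lia.
(* The moment is a trace of the power alpha / 2 of the Gram matrix; this division is the 1 in
   101. *)
- exists (mpo_prog (SDiv (SGet 2 [::]) (SCst 2))), 101%N.
  move=> sol nA nB chi W alpha n1 rhoW alpha0; have := mpo_bond_gt0 rhoW.
  case: chi W rhoW => // c W _ _; split; last exact: cost_mpo_prog.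
  apply: mpo_prog_correct => // [l m' m'2|]; last by rewrite gt_eqF ?divr_gt0 ?ltr0n.
  rewrite /= m'2 /with_scalar putE /=.
  by field.
- exists mps_ccnr_prog, 100%N => sol nA nB nC chi A n1 normA.
  have := mps_bond_gt0 normA; case: chi A normA => // c A _ _.
  by split; [apply: mps_ccnr_prog_correct|apply: cost_mps_ccnr_prog].
- exists mps_moment4_prog, 100%N => sol nA nB nC chi A n1 normA.
  have := mps_bond_gt0 normA; case: chi A normA => // c A _ _.
  by split; [apply: mps_moment4_prog_correct|apply: cost_mps_moment4_prog].
Qed.
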